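(* Let $H$ be a homogeneous relation on a finite set $V$ with $|V|\ge2$, given as input by the list, for each $v\in V$, of the partition of $V\setminus\{v\}$ into equivalence classes of $H_v$, and let $x\in V$. The partition $MHS(x)$ of $V\setminus\{x\}$ into the inclusion-maximal homogeneous sets not containing $x$ can be computed in $O(|V|^2)$ time.
   Context: $V$ is a finite set. A reflectless triple is a triple $(x,y,z)\in V^3$ with $x\neq y$ and $x\neq z$, written $(x|yz)$. A homogeneous relation $H$ on $V$ is a set of reflectless triples (we write $H(s|xy)$ when $(s|xy)\in H$) such that for every $s\in V$ the binary relation $H_s=\{(x,y): H(s|xy)\}$ is an equivalence relation on $V\setminus\{s\}$. For $X\subseteq V$ and $s\notin X$, $s$ distinguishes $X$ if there are $x,y\in X$ with not $H(s|xy)$. A homogeneous set is a nonempty $M\subseteq V$ such that no element of $V\setminus M$ distinguishes $M$. The inclusion-maximal homogeneous sets not containing $x$ form a partition of $V\setminus\{x\}$, denoted $MHS(x)$. *)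

(* Defs.v *)
From mathcomp Require Import all_boot.
Set Implicit Arguments. Unset Strict Implicit. Unset Printing Implicit Defensive.

(* H s y z  encodes  H(s|yz).                                          *)

Definition homogeneous_relation (n : nat) (H : 'I_n -> 'I_n -> 'I_n -> bool) :=
  [/\ (forall s y z, H s y z -> (s != y) && (s != z)),
      (forall s y, s != y -> H s y y),
      (forall s y z, H s y z -> H s z y) &
      (forall s y z w, H s y z -> H s z w -> H s y w)].

(* s distinguishes X (s \notin X assumed by the caller) *)
Definition distinguishes n (H : 'I_n -> 'I_n -> 'I_n -> bool) (s : 'I_n)
  (X : {set 'I_n}) : bool :=
  [exists y in X, exists z in X, ~~ H s y z].

Definition homogeneous_set n (H : 'I_n -> 'I_n -> 'I_n -> bool)
  (M : {set 'I_n}) : bool :=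
  (M != set0) && [forall s in ~: M, ~~ distinguishes H s M].

Definition MHS n (H : 'I_n -> 'I_n -> 'I_n -> bool) (x : 'I_n)
  : {set {set 'I_n}} :=
  [set M | maxset (fun M : {set 'I_n} => homogeneous_set H M && (x \notin M)) M].

Definition valid_input n (H : 'I_n -> 'I_n -> 'I_n -> bool)
  (P : 'I_n -> seq (seq 'I_n)) : Prop :=
  forall v : 'I_n,
  [/\ all (fun c => (c != [::]) && uniq c && (v \notin c)) (P v),
      (forall y, y != v -> count (fun c => y \in c) (P v) = 1) &
      (forall y z, y != v -> z != v ->
         H v y z = has (fun c => (y \in c) && (z \in c)) (P v))].

Definition encode_input n (x : 'I_n) (P : 'I_n -> seq (seq 'I_n)) : seq nat :=
  [:: n; val x] ++
  flatten [seq size (P v) :: flatten [seq size c :: map val c | c <- P v]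
          | v <- enum 'I_n].

(* Machine model: a unit-cost RAM with natural-number registers and    *)
(* memory (addition, truncated subtraction, comparison, indirect       *)
(* addressing).  Each executed instruction costs one time step.        *)
Inductive instr : Type :=
| IConst of nat & nat
| IAdd of nat & nat & nat
| ISub of nat & nat & nat
| ILoad of nat & nat
| IStore of nat & nat
| IJlt of nat & nat & nat
| IJmp of nat
| IHalt.

Record rstate : Type := RState {
  pc : nat; reg : nat -> nat; mem : nat -> nat }.

Definition upd (f : nat -> nat) (i v : nat) : nat -> nat :=
  fun j => if j == i then v else f j.

(* one step; None when the machine has halted (IHalt or pc out of range) *)
Definition step (prog : seq instr) (s : rstate) : option rstate :=
  let: RState p r m := s in
  match nth IHalt prog p with
  | IConst d c => Some (RState p.+1 (upd r d c) m)
  | IAdd d a b => Some (RState p.+1 (upd r d (r a + r b)) m)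
  | ISub d a b => Some (RState p.+1 (upd r d (r a - r b)) m)
  | ILoad d a => Some (RState p.+1 (upd r d (m (r a))) m)
  | IStore a s' => Some (RState p.+1 r (upd m (r a) (r s')))
  | IJlt a b t => Some (RState (if r a < r b then t else p.+1) r m)
  | IJmp t => Some (RState t r m)
  | IHalt => None
  end.

Fixpoint exec (prog : seq instr) (t : nat) (s : rstate) : option rstate :=
  match t with
  | 0 => Some s
  | t'.+1 => match step prog s with
             | Some s' => exec prog t' s'
             | None => None
             end
  end.

Definition halted (prog : seq instr) (s : rstate) : bool :=
  if step prog s is None then true else false.

Definition init_state (inp : seq nat) : rstate :=
  RState 0 (fun _ => 0) (fun a => nth 0 inp a).

Fixpoint decode_list (m : nat -> nat) (len a : nat) : seq nat :=
  match len with
  | 0 => [::]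
  | l.+1 => m a :: decode_list m l a.+1
  end.

Fixpoint decode_classes (m : nat -> nat) (k a : nat) : seq (seq nat) :=
  match k with
  | 0 => [::]
  | k'.+1 => decode_list m (m a) a.+1 :: decode_classes m k' (a + (m a)).+1
  end.

Definition output (s : rstate) : seq (seq nat) :=
  decode_classes (mem s) (mem s (reg s 0)) (reg s 0).+1.

Definition represents_MHS n (H : 'I_n -> 'I_n -> 'I_n -> bool) (x : 'I_n)
  (out : seq (seq nat)) : Prop :=
  [/\ all (fun c => uniq c && all (fun e => e < n) c) out,
      size out = #|MHS H x| &
      (forall M : {set 'I_n},
         (M \in MHS H x) = has (fun c => M == [set i : 'I_n | val i \in c]) out)].

(* Main.v *)
Require Import Defs.
From mathcomp Require Import all_boot zify.
Set Implicit Arguments. Unset Strict Implicit. Unset Printing Implicit Defensive.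

(* MHS(x) is the coarsest partition of V \ {x} no part of which is
   distinguished by a vertex outside of it, and it is reached from {x}, V \ {x}
   by partition refinement. A homogeneous set avoiding x is never cut: a vertex
   s splits a part X only if s lies outside X, hence outside every homogeneous
   set contained in X, so that all of that set agrees on s.

   The vertices are kept in an array in which every part is an interval. When
   an interval [p, q) is cut at m, the triple (p, m, q) enters a queue, meaning
   that each vertex of either side has still to be compared with the other
   side; later refinements permute vertices only within [p, m) and [m, q), so
   the triple stays meaningful. Comparing s with an interval takes one table
   lookup per position, against the first position of the part, plus a linear
   cost per cut. An ordered pair of vertices is compared once, right after it
   has been separated, so the total is O(n^2): the sum over the parts of their
   numbers of pairs pays both for the cuts and for the triples they create. *)

(** * Structured programs and their running time *)

(** The two halves of [Inv] bound the answer from both sides. [closed_lab] keeps every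
    undistinguished set avoiding [x] inside one part; [settled] says that a vertex outside of a part
    sees it as constant, unless that comparison is still owed. Once nothing is owed, the parts are
    homogeneous and absorb every homogeneous set avoiding [x], so they are the maximal ones. Running
    time is amortized, whereas a loop only carries a decreasing budget. The amortization therefore
    sits in [potential], which the budget has to cover at every loop head of the refinement. A pair
    of positions weighs 300 while it lies in one part and 200 while its comparison, in both
    directions, is queued. A cut into sides of sizes a and b releases 100ab, which pays its linear
    cost because a + b <= 2ab; the 200ab of a triple taken from the queue pay for two passes, whose
    cost is at most 170ab. The machine has neither multiplication nor an equality test: row
    addresses are tabulated, and equality is tested by truncated differences. *)

Lemma exec_add prog t1 t2 s s' :
  exec prog t1 s = Some s' -> exec prog (t1 + t2) s = exec prog t2 s'.
Proof.
elim: t1 s => [|t1 IH] s /=; first by case=> ->.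
by case: step => // s1; apply: IH.
Qed.

Inductive cmd : Type :=
| Block of seq instr
| Seq of cmd & cmd
| If of nat & nat & cmd & cmd
| While of nat & nat & cmd.

Fixpoint len (c : cmd) : nat :=
  match c with
  | Block l => size l
  | Seq c1 c2 => len c1 + len c2
  | If _ _ c1 c2 => (len c2 + len c1).+2
  | While _ _ c1 => (len c1).+3
  end.

(** Jump targets are absolute, hence the load address [o]. [IJlt] falls through when its test fails,
    so the second branch of [If] is placed first. A round of [While] costs two jumps besides its
    body, and so does leaving it; an [If] costs one or two. *)
Fixpoint code (o : nat) (c : cmd) : seq instr :=
  match c with
  | Block l => l
  | Seq c1 c2 => code o c1 ++ code (o + len c1) c2
  | If a b c1 c2 =>
      IJlt a b (o.+1 + len c2).+1 :: code o.+1 c2 ++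
      IJmp (o.+2 + len c2 + len c1) :: code (o.+1 + len c2).+1 c1
  | While a b c1 =>
      IJlt a b o.+2 :: IJmp (o.+2 + len c1).+1 :: rcons (code o.+2 c1) (IJmp o)
  end.

Lemma size_code o c : size (code o c) = len c.
Proof.
elim: c o => [l|c1 IH1 c2 IH2|a b c1 IH1 c2 IH2|a b c IH] o //=.
- by rewrite size_cat IH1 IH2.
- by rewrite size_cat /= IH1 IH2 addnS.
- by rewrite size_rcons IH.
Qed.

(** Control instructions yield [False], so a block for which this holds is straight-line and takes
    exactly [size l] steps. *)
Fixpoint effects (l : seq instr) (K : (nat -> nat) -> (nat -> nat) -> Prop)
    (r m : nat -> nat) : Prop :=
  match l with
  | [::] => K r m
  | i :: l' =>
    match i with
    | IConst d c => effects l' K (upd r d c) m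
    | IAdd d a b => effects l' K (upd r d (r a + r b)) m
    | ISub d a b => effects l' K (upd r d (r a - r b)) m
    | ILoad d a => effects l' K (upd r d (m (r a))) m
    | IStore a b => effects l' K r (upd m (r a) (r b))
    | _ => False
    end
  end.

(* Weakest precondition with a time budget [B]: the postcondition receives the
   budget left over. The budget is also the variant of every loop. *)
Fixpoint wp (c : cmd) (Q : nat -> (nat -> nat) -> (nat -> nat) -> Prop)
    (B : nat) (r m : nat -> nat) : Prop :=
  match c with
  | Block l => size l <= B /\ effects l (Q (B - size l)) r m
  | Seq c1 c2 => wp c1 (wp c2 Q) B r m
  | If a b c1 c2 =>
      2 <= B /\ (if r a < r b then wp c1 Q (B - 2) r m else wp c2 Q (B - 2) r m)
  | While a b c1 =>
      exists2 I : nat -> (nat -> nat) -> (nat -> nat) -> Prop, I B r m &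
      forall B' r' m', I B' r' m' -> 2 <= B' /\
        (if r' a < r' b then wp c1 I (B' - 2) r' m' else Q (B' - 2) r' m')
  end.


(** Polymorphic because it describes the program text, read through [nth IHalt], as well as the
    memory. *)
Fixpoint lay (T : Type) (m : nat -> T) (a : nat) (l : seq T) : Prop :=
  if l is x :: l' then m a = x /\ lay m a.+1 l' else True.

Lemma lay_cat T (m : nat -> T) a l1 l2 :
  lay m a (l1 ++ l2) <-> lay m a l1 /\ lay m (a + size l1) l2.
Proof.
elim: l1 a => [|x l1 IH] a /=; first by rewrite addn0; tauto.
rewrite IH addnS addSn; tauto.
Qed.

Lemma lay_nth T (m : nat -> T) x0 a l i :
  lay m a l -> i < size l -> m (a + i) = nth x0 l i.
Proof.
elim: l a i => [|x l IH] a [|i] //= [mx ml]; first by rewrite addn0.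
by rewrite addnS -addSn; apply: IH.
Qed.

Lemma nth_lay T (m : nat -> T) x0 a l :
  (forall i, i < size l -> m (a + i) = nth x0 l i) -> lay m a l.
Proof.
elim: l a => [|x l IH] a //= ml; split; first by have := ml 0 isT; rewrite addn0.
by apply: IH => i lti; rewrite addSn -addnS ml.
Qed.

Lemma eq_lay T (m m' : nat -> T) a l :
  (forall i, a <= i < a + size l -> m' i = m i) -> lay m a l -> lay m' a l.
Proof.
elim: l a => [|x l IH] a //= mE [<- ml]; split; first by apply: mE; lia.
by apply: IH ml => i ri; apply: mE; lia.
Qed.

Lemma effects_sound prog o l K r m :
  lay (nth IHalt prog) o l -> effects l K r m ->
  exists r' m', exec prog (size l) (RState o r m)
                = Some (RState (o + size l) r' m') /\ K r' m'.
Proof.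
elim: l o r m => [|i l IH] o r m /=; first by exists r, m; rewrite addn0.
rewrite addnS -addSn => -[-> ll]; case: i => //= *; exact: IH.
Qed.

Lemma wp_sound prog c Q o B r m :
  lay (nth IHalt prog) o (code o c) -> wp c Q B r m ->
  exists t r' m' B', [/\ t + B' <= B,
    exec prog t (RState o r m) = Some (RState (o + len c) r' m') & Q B' r' m'].
Proof.
elim: c Q o B r m => [l|c1 IH1 c2 IH2|a b c1 IH1 c2 IH2|a b c IH] Q o B r m /=.
- move=> ll [lB /(effects_sound ll) [r' [m' [ex q]]]].
  by exists (size l), r', m', (B - size l); split=> //; rewrite subnKC.
- move=> /lay_cat; rewrite size_code => -[l1 l2].
  move=> /(IH1 _ _ _ _ _ l1) [t1 [r1 [m1 [B1 [le1 ex1 w2]]]]].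
  have [t2 [r2 [m2 [B2 [le2 ex2 q]]]]] := IH2 _ _ _ _ _ l2 w2.
  exists (t1 + t2), r2, m2, B2; split=> //; first by lia.
  by rewrite (exec_add _ ex1) addnA.
- move=> [jlt /lay_cat [l2 /=]]; rewrite size_code => -[jmp l1] [B2].
  case: ltnP => [lt|ge].
  + move=> /(IH1 _ _ _ _ _ l1) [t1 [r1 [m1 [B1 [le1 ex1 w2]]]]].
    exists t1.+1, r1, m1, B1; split=> //; first by lia.
    by rewrite /= jlt lt ex1; congr (Some (RState _ _ _)); lia.
  + move=> /(IH2 _ _ _ _ _ l2) [t1 [r1 [m1 [B1 [le1 ex1 w2]]]]].
    exists (t1 + 1).+1, r1, m1, B1; split=> //; first by lia.
    rewrite /= jlt ltnNge ge /= (exec_add _ ex1) /= jmp.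
    by congr (Some (RState _ _ _)); lia.
- move=> [jlt [jout]]; rewrite -cats1 => /lay_cat [lc /=].
  rewrite size_code => -[back _] [I IB Istep].
  elim/ltn_ind: B r m IB => B IHB r m /Istep [B2]; case: ltnP => [lt|ge].
  + move=> /(IH _ _ _ _ _ lc) [t1 [r1 [m1 [B1 [le1 ex1 I1]]]]].
    have [|t2 [r2 [m2 [B' [le2 ex2 q]]]]] := IHB B1 _ r1 m1 I1; first by lia.
    exists (t1 + t2.+1).+1, r2, m2, B'; split=> //; first by lia.
    by rewrite /= jlt lt (exec_add _ ex1) /= back ex2.
  + move=> q; exists 2, r, m, (B - 2); split=> //; first by lia.
    rewrite /= jlt ltnNge ge /= jout.
    by congr (Some (RState _ _ _)); lia.
Qed.

Lemma updE f i v : upd f i v i = v.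
Proof. by rewrite /upd eqxx. Qed.

Lemma updN f i v j : j <> i -> upd f i v j = f j.
Proof. by rewrite /upd; case: eqP. Qed.

Lemma upd_look f i v j w : (j == i) = false -> f j = w -> upd f i v j = w.
Proof. by rewrite /upd => ->. Qed.

(** * Symbolic execution rules *)

Section Rules.

Variables (l : seq instr) (K : (nat -> nat) -> (nat -> nat) -> Prop).
Variables (r m : nat -> nat) (va vb : nat).

Lemma do_nil : K r m -> effects [::] K r m. Proof. by []. Qed.

Lemma do_const d c : effects l K (upd r d c) m -> effects (IConst d c :: l) K r m.
Proof. by []. Qed.

(** Operand values are premises solved by [look], so that a new register content mentions values
    instead of the whole history of updates. *)
Lemma do_add d a b : r a = va -> r b = vb ->
  effects l K (upd r d (va + vb)) m -> effects (IAdd d a b :: l) K r m.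
Proof. by move=> <- <-. Qed.

Lemma do_sub d a b : r a = va -> r b = vb ->
  effects l K (upd r d (va - vb)) m -> effects (ISub d a b :: l) K r m.
Proof. by move=> <- <-. Qed.

Lemma do_load d a w v : m w = v -> r a = va -> va = w ->
  effects l K (upd r d v) m -> effects (ILoad d a :: l) K r m.
Proof. by move=> <- <- <-. Qed.

Lemma do_store a b : r a = va -> r b = vb ->
  effects l K r (upd m va vb) -> effects (IStore a b :: l) K r m.
Proof. by move=> <- <-. Qed.

Lemma wp_block Q B : size l <= B -> effects l (Q (B - size l)) r m ->
  wp (Block l) Q B r m.
Proof. by []. Qed.

Lemma wp_seq c1 c2 Q B : wp c1 (wp c2 Q) B r m -> wp (Seq c1 c2) Q B r m.
Proof. by []. Qed.

Lemma wp_if a b c1 c2 Q B : r a = va -> r b = vb -> 2 <= B ->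
  (va < vb -> wp c1 Q (B - 2) r m) -> (vb <= va -> wp c2 Q (B - 2) r m) ->
  wp (If a b c1 c2) Q B r m.
Proof. by move=> <- <- B2 lt ge; split=> //; case: ltnP. Qed.

End Rules.

Lemma wp_while (I : nat -> (nat -> nat) -> (nat -> nat) -> Prop) a b c Q B r m :
  I B r m ->
  (forall B' r' m', I B' r' m' -> 2 <= B') ->
  (forall B' r' m', I B' r' m' -> r' a < r' b -> wp c I (B' - 2) r' m') ->
  (forall B' r' m', I B' r' m' -> r' b <= r' a -> Q (B' - 2) r' m') ->
  wp (While a b c) Q B r m.
Proof.
move=> I0 I2 Istep Iend; exists I => // B' r' m' I'.
by split; [exact: I2 I'|case: ltnP; [exact: Istep|exact: Iend]].
Qed.

Arguments effects : simpl never.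
Arguments wp : simpl never.

Ltac look :=
  lazymatch goal with
  | |- upd _ ?i _ ?i = _ => apply: updE
  | |- upd _ _ _ _ = _ => apply: upd_look; [reflexivity | look]
  | _ => first [eassumption | reflexivity]
  end.

Ltac calc :=
  repeat lazymatch goal with
  | |- effects [::] _ _ _ => apply: do_nil
  | |- effects (IConst _ _ :: _) _ _ _ => apply: do_const
  | |- effects (IAdd _ _ _ :: _) _ _ _ => eapply do_add; [look | look | ]
  | |- effects (ISub _ _ _ :: _) _ _ _ => eapply do_sub; [look | look | ]
  | |- effects (IStore _ _ :: _) _ _ _ => eapply do_store; [look | look | ]
  end.

Ltac load H := eapply (do_load H); [look | try lia | calc].

Ltac reg := etransitivity; [look | try lia].

(** * Partition refinement *)

Definition item := (nat * nat * nat)%type.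

Definition between (it : item) (u i : nat) : bool :=
  let: (l, m, h) := it in
  (l <= u < m) && (m <= i < h) || (m <= u < h) && (l <= i < m).

Definition pending (items : seq item) (u i : nat) : bool :=
  has (fun it => between it u i) items.

(** The equations on [lab] make the three ends boundaries of parts, so each side is a union of
    parts; [n] counts as a boundary through the sentinel [lab n = n]. *)
Definition item_ok (n : nat) (lab : nat -> nat) (it : item) : bool :=
  let: (l, m, h) := it in
  [&& l < m, m < h, h <= n, lab l == l, lab m == m & lab h == h].

(** [cl s y] stands for the number of the class of [y] with respect to [s]; this is homogeneity
    without nonemptiness, for predicates on [nat]. *)
Definition undistinguished (n : nat) (cl : nat -> nat -> nat) (S : nat -> bool) :=
  forall s y z, s < n -> y < n -> z < n -> ~~ S s -> S y -> S z ->
  cl s y = cl s z.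

(* [ord] lists the vertices so that parts are intervals of positions, [lab i]
   is the first position of the part of position [i], [items] are the splits
   whose two sides have not been compared yet, and [rest] is the portion of the
   current split that remains to be compared. *)
Record Inv (n x : nat) (cl : nat -> nat -> nat) (ord lab : nat -> nat)
    (items : seq item) (rest : nat -> nat -> bool) : Prop := {
  ord_lt : forall i, i < n -> ord i < n;
  ord_injective : forall i j, i < n -> j < n -> ord i = ord j -> i = j;
  ord_first : ord 0 = x;
  lab1 : lab 1 = 1;
  labn : lab n = n;
  lab_le : forall i, i <= n -> lab i <= i;
  lab_id : forall i, i <= n -> lab (lab i) = lab i;
  lab_mono : forall i j, i <= j -> j <= n -> lab i <= lab j;
  closed_lab : forall S i j, undistinguished n cl S -> ~~ S x -> i < n -> j < n ->
    S (ord i) -> S (ord j) -> lab i = lab j;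
  settled : forall u i j, u < n -> i < n -> j < n -> lab i = lab j ->
    lab u <> lab i -> ~~ pending items u i -> ~~ rest u i ->
    cl (ord u) (ord i) = cl (ord u) (ord j);
  items_ok : all (item_ok n lab) items }.

Section Refinement.

Variables (n x : nat) (cl : nat -> nat -> nat).
Local Notation Inv := (Inv n x cl).

(** Only the bookkeeping changes: a pair dropped from the debts [items] and [rest] has to be shown
    settled, and nothing else. *)
Lemma Inv_weaken ord lab items items' rest rest' :
  Inv ord lab items rest -> all (item_ok n lab) items' ->
  (forall u i j, u < n -> i < n -> j < n -> lab i = lab j -> lab u <> lab i ->
     ~~ pending items' u i -> ~~ rest' u i ->
     (pending items u i || rest u i) ->
     cl (ord u) (ord i) = cl (ord u) (ord j)) ->
  Inv ord lab items' rest'.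
Proof.
case=> o1 o2 o3 l1 ln ll li lm cS st ok ok' sett; split=> //.
move=> u i j un inn jn lij lui np nr.
have [/orP|] := boolP (pending items u i || rest u i); first by move=> /orP; auto.
by rewrite negb_or => /andP [np' nr']; apply: st.
Qed.

(** Stands in for a permutation of [[p, q)]: it relates a position to the former position of its
    vertex, and no bijection has to be named. *)
Definition shuffled (p q a b : nat) : Prop :=
  a = b \/ (p <= a < q) && (p <= b < q).

(** No part straddles [b], since [lab] is monotone and [b] is its own label. *)
Lemma below_boundary lab a a' b :
  (forall i j, i <= j -> j <= n -> lab i <= lab j) ->
  (forall i, i <= n -> lab i <= i) ->
  b <= n -> lab b = b -> a <= n -> a' <= n -> lab a = lab a' -> a < b -> a' < b.
Proof.
move=> mono le bn lb an an' laa ab; rewrite ltnNge; apply/negP => ba.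
have := mono _ _ ba an'; have := le _ an; lia.
Qed.

(** Each side of an item is a union of parts, so being owed depends on parts only. This transports
    debts along a shuffle inside a part. *)
Lemma pending_part ord lab items rest u u' i i' :
  Inv ord lab items rest -> u < n -> u' < n -> i < n -> i' < n ->
  lab u = lab u' -> lab i = lab i' -> pending items u i -> pending items u' i'.
Proof.
move=> I un un' inn in' luu lii /hasP [[[l m] h] it bet]; apply/hasP; exists (l, m, h) => //.
have /= := allP (items_ok I) _ it.
case/and5P=> lm mh hn /eqP ll /andP [/eqP lm' /eqP lh].
have bd := below_boundary (lab_mono I) (lab_le I).
have bu b : b <= n -> lab b = b -> (u < b) = (u' < b).
  by move=> bn lb; apply/idP/idP; apply: bd => //; lia.
have bi b : b <= n -> lab b = b -> (i < b) = (i' < b).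
  by move=> bn lb; apply/idP/idP; apply: bd => //; lia.
move: bet; rewrite /between !(leqNgt _ u) !(leqNgt _ i) !(leqNgt _ u') !(leqNgt _ i').
by rewrite !bu ?bi //; lia.
Qed.

Definition relabel (lab : nat -> nat) (m q j : nat) : nat :=
  if m <= j < q then m else lab j.

Section Split.

Variables (ord lab ord' : nat -> nat) (items : seq item)
  (rest : nat -> nat -> bool) (p m q u : nat).
Hypotheses (I : Inv ord lab items rest) (pm : p < m) (mq : m < q) (qn : q <= n)
  (part : forall j, j <= n -> (lab j == p) = (p <= j < q)).

Let labm : lab m = p.
Proof. by apply/eqP; rewrite part; lia. Qed.

Let labp : lab p = p.
Proof. by apply/eqP; rewrite part; lia. Qed.

Let part_in j : p <= j < q -> lab j = p.
Proof. by move=> h; apply/eqP; rewrite part; lia. Qed.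

Let relabel_lab i j : i <= n -> j <= n ->
  relabel lab m q i = relabel lab m q j -> lab i = lab j.
Proof.
(* The label [m] is new: labels are fixed by [lab], whereas [lab m = p]. *)
have aux k : k <= n -> lab k <> m.
  move=> kn lk; have := lab_id I kn; rewrite lk; lia.
move=> inn jn; rewrite /relabel; case: ifP => hi; case: ifP => hj // e.
- by rewrite !part_in //; lia.
- by case: (aux j).
- by case: (aux i).
Qed.

Let p_gt0 : 0 < p.
Proof.
rewrite lt0n; apply/eqP => p0.
have := lab1 I; rewrite part_in ?p0 //; lia.
Qed.

(** The triple [(p, m, q)] covers exactly the pairs separated by the cut. Any other separated pair
    was separated before and pulls back to its former positions, which is why [rest] has to be
    stable under shuffling. The side [[m, q)] need not be uniform for [u]. *)
Lemma Inv_split :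
  u < n -> lab u <> p ->
  (forall j, j < n -> ord' j < n) ->
  (forall i j, i < n -> j < n -> ord' i = ord' j -> i = j) ->
  (forall j, exists2 j', shuffled p q j j' & ord' j = ord j') ->
  (forall i j, p <= i < m -> m <= j < q ->
     cl (ord u) (ord' i) <> cl (ord u) (ord' j)) ->
  (forall v i v' i', rest v' i' -> shuffled p q v v' -> shuffled p q i i' ->
     rest v i) ->
  Inv ord' (relabel lab m q) (rcons items (p, m, q)) rest.
Proof.
move=> un lu lt' inj' pre dist stab.
have labsh a b : shuffled p q a b -> lab a = lab b.
  by case=> [-> //|/andP [/part_in -> /part_in ->]].
have shn a b : shuffled p q a b -> a < n -> b < n by case=> [-> //|]; lia.
have lab_keep j : lab j = j -> relabel lab m q j = j.
  move=> lj; rewrite /relabel; case: ifP => // mjq.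
  by have lp : lab j = p by [apply: part_in; lia]; lia.
split=> //.
- have [j'] := pre 0; case=> [<- ->|]; [exact: ord_first I|lia].
- exact: lab_keep (lab1 I).
- exact: lab_keep (labn I).
- by move=> i inn; rewrite /relabel; have := lab_le I inn; case: ifP; lia.
- move=> i inn; rewrite {2 3}/relabel; case: ifP => hi.
    by rewrite /relabel; case: ifP; lia.
  exact: lab_keep (lab_id I inn).
- move=> i j ij jn; have mono := lab_mono I ij jn; rewrite /relabel.
  case: ifP => hi; case: ifP => hj //.
    have pj : p <= lab j by rewrite -labm; apply: (lab_mono I); lia.
    have nlj : lab j <> p by move/eqP; rewrite part; lia.
    have [lt|//] := ltnP (lab j) m.
    have : lab (lab j) = p by [apply: part_in; lia].
    by rewrite (lab_id I jn).
  have : i < m by lia.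
  by have : i <= n by [lia]; move=> /(lab_le I); lia.
- move=> S i j cS Sx inn jn Si Sj.
  have [i' shi oi] := pre i; have [j' shj oj] := pre j.
  have inn' := shn _ _ shi inn; have jn' := shn _ _ shj jn.
  have lij : lab i = lab j.
    rewrite (labsh _ _ shi) (labsh _ _ shj).
    by apply: (closed_lab I cS); rewrite -?oi -?oj.
  have Su : lab i = p -> ~~ S (ord u).
    move=> lip; apply/negP => Su; case: lu; rewrite -lip (labsh _ _ shi).
    by apply: (closed_lab I cS); rewrite -?oi.
  rewrite /relabel; case: ifP => hi; case: ifP => hj //.
  + have lip : lab i = p by apply: part_in; lia.
    have := part (ltnW jn); rewrite -lij lip eqxx => /esym hj'.
    case: (dist j i); rewrite ?hi //; first by lia.
    by apply: cS => //; [exact: (ord_lt I)|exact: lt'|exact: lt'|exact: Su].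
  + have ljp : lab j = p by apply: part_in; lia.
    have := part (ltnW inn); rewrite lij ljp eqxx => /esym hi'.
    case: (dist i j); rewrite ?hj //; first by lia.
    apply: cS => //; [exact: (ord_lt I)|exact: lt'|exact: lt'|].
    by apply: Su; rewrite lij.
- move=> v i j vn inn jn lij lvi np nr.
  have [v' shv ->] := pre v; have [i' shi ->] := pre i; have [j' shj ->] := pre j.
  have lab_ij := relabel_lab (ltnW inn) (ltnW jn) lij.
  move: np; rewrite /pending has_rcons negb_or => /andP [nb np].
  (* Had the two shared a part before, the cut would have separated them and the new item would
     cover them. *)
  have lvi' : lab v <> lab i.
    move=> e; move: lvi nb; rewrite /relabel /between e.
    case: ifP => hv; case: ifP => hi //.
    + have := part (ltnW inn); rewrite -e (part_in _) ?eqxx; lia.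
    + have := part (ltnW vn); rewrite e (part_in _) ?eqxx; lia.
  apply: (settled I); try exact: shn _ _ _ _.
  + exact: shn shv vn.
  + exact: shn shi inn.
  + exact: shn shj jn.
  + by rewrite -(labsh _ _ shi) -(labsh _ _ shj).
  + by rewrite -(labsh _ _ shi) -(labsh _ _ shv).
  + apply: contra np; apply: (pending_part I) => //.
    * exact: shn shv vn.
    * exact: shn shi inn.
    * by rewrite -(labsh _ _ shv).
    * by rewrite -(labsh _ _ shi).
  + by apply: contra nr => /stab; apply.
- rewrite all_rcons /=; apply/andP; split.
    rewrite pm mq qn lab_keep // eqxx /relabel ltnn andbF leqnn mq eqxx /=.
    have := part qn; rewrite ltnn andbF => lq.
    have := lab_id I qn; have := lab_le I qn; have := lab_mono I (ltnW mq) qn.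
    have := @part_in (lab q); lia.
  apply: sub_all (items_ok I) => -[[l k] h] /=.
  by case/and5P=> -> -> -> /eqP /lab_keep -> /andP [/eqP /lab_keep -> /eqP /lab_keep ->]; rewrite !eqxx.
Qed.

End Split.

(** Unordered pairs inside a part, each counted at its later position: the part of [i] begins at
    [lab i]. *)
Definition same_part_pairs (lab : nat -> nat) : nat := \sum_(0 <= i < n) (i - lab i).

Lemma same_part_pairs_relabel lab p m q :
  p <= m -> m <= q -> q <= n -> (forall j, m <= j < q -> lab j = p) ->
  same_part_pairs lab = same_part_pairs (relabel lab m q) + (m - p) * (q - m).
Proof.
move=> pm mq qn labp; rewrite /same_part_pairs.
rewrite !(@big_cat_nat _ _ _ m 0 n) ?(@big_cat_nat _ _ _ q m n) //=; try lia.
have e1 : \sum_(0 <= i < m) (i - relabel lab m q i) = \sum_(0 <= i < m) (i - lab i).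
  by apply: eq_big_nat => i ri; rewrite /relabel; case: ifP => //; lia.
have e2 : \sum_(q <= i < n) (i - relabel lab m q i) = \sum_(q <= i < n) (i - lab i).
  by apply: eq_big_nat => i ri; rewrite /relabel; case: ifP => //; lia.
have e3 : \sum_(m <= i < q) (i - lab i)
        = \sum_(m <= i < q) (i - relabel lab m q i) + (m - p) * (q - m).
  rewrite mulnC -sum_nat_const_nat -big_split /=.
  by apply: eq_big_nat => i ri; rewrite labp // /relabel ri; lia.
by rewrite e1 e2 e3; lia.
Qed.

(** The pairs that straddle a queued cut, counted once for both directions of comparison. *)
Definition work (items : seq item) : nat :=
  sumn [seq (it.1.2 - it.1.1) * (it.2 - it.1.2) | it <- items].

Lemma work_rcons items it :
  work (rcons items it) = work items + (it.1.2 - it.1.1) * (it.2 - it.1.2).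
Proof. by rewrite /work map_rcons sumn_rcons. Qed.

End Refinement.

(** * The program *)

(* [rA0, rA1) and [rB0, rB1) are the intervals being compared, [rU] and [rI] the
   current positions in them, [rRS] the row of the class table for the vertex at
   [rU]; [rQH] and [rQT] delimit the queue. Low numbers are the long-lived
   registers, so that what a piece of code preserves is an initial segment. The
   parser reuses registers 9 to 12 and 20. *)
Local Notation rZ := 1 (only parsing).
Local Notation rONE := 2 (only parsing).
Local Notation rN := 3 (only parsing).
Local Notation rX := 4 (only parsing).
Local Notation rROW := 5 (only parsing).
Local Notation rORD := 6 (only parsing).
Local Notation rLAB := 7 (only parsing).
Local Notation rQH := 8 (only parsing).
Local Notation rA0 := 9 (only parsing).
Local Notation rA1 := 10 (only parsing).
Local Notation rB0 := 11 (only parsing).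
Local Notation rB1 := 12 (only parsing).
Local Notation rU := 13 (only parsing).
Local Notation rRS := 14 (only parsing).
Local Notation rI := 15 (only parsing).
Local Notation rP := 16 (only parsing).
Local Notation rC := 17 (only parsing).
Local Notation rP1 := 18 (only parsing).
Local Notation rQT := 19 (only parsing).
Local Notation rM := 20 (only parsing).
Local Notation rJ := 21 (only parsing).
Local Notation rT := 22 (only parsing).
Local Notation rTJ := 23 (only parsing).
Local Notation rY := 24 (only parsing).
Local Notation rD := 25 (only parsing).
Local Notation rE := 26 (only parsing).
Local Notation rO := 27 (only parsing).
Local Notation rH := 28 (only parsing).
Local Notation rCNT := 29 (only parsing).
Local Notation rR := 9 (only parsing).
Local Notation rV := 10 (only parsing).
Local Notation rK := 11 (only parsing).
Local Notation rEND := 12 (only parsing).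
Local Notation rA := 20 (only parsing).

Fixpoint seqs (c : cmd) (cs : seq cmd) : cmd :=
  if cs is c' :: cs' then Seq c (seqs c' cs') else c.

(** The work area starts at 2 + 3n^2, beyond the input, since a row of the input takes at most 2n +
    1 cells; the product is formed by repeated addition. From there on lie [n] row addresses, [n]
    cells of [ord], [n + 1] of [lab], the class table, the queue and, behind it, the output. *)
Definition base_code : cmd :=
  seqs (Block [:: IConst rONE 1; ILoad rN rZ; ILoad rX rONE; IConst rROW 2])
    [:: While rI rN (Block [:: IAdd rROW rROW rN; IAdd rROW rROW rN;
                               IAdd rROW rROW rN; IAdd rI rI rONE]);
        Block [:: IAdd rORD rROW rN; IAdd rLAB rORD rN; IAdd rR rLAB rN;
                  IAdd rR rR rONE; IConst rA 2]].

Definition class_code : cmd :=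
  While rA rEND (Block [:: ILoad rY rA; IAdd rT rR rY; IStore rT rK;
                           IAdd rA rA rONE]).

Definition row_code : cmd :=
  While rZ rK (seqs
    (Block [:: ILoad rEND rA; IAdd rA rA rONE; IAdd rEND rA rEND])
    [:: class_code; Block [:: ISub rK rK rONE]]).

Definition parse_code : cmd :=
  While rV rN (seqs
    (Block [:: ILoad rK rA; IAdd rA rA rONE; IAdd rT rROW rV; IStore rT rR;
               IAdd rT rORD rV; IStore rT rV; IAdd rT rLAB rV; IStore rT rONE])
    [:: row_code; Block [:: IAdd rR rR rN; IAdd rV rV rONE]]).

(** Exchanging [x] with vertex 0 puts [x] at position 0, as a part of its own; label [n] at position
    [n] is the sentinel that ends the last part. The queue begins right after the class table. *)
Definition start_code : cmd :=
  Block [:: IStore rLAB rZ; IAdd rT rLAB rN; IStore rT rN;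
            IStore rORD rX; IAdd rT rORD rX; IStore rT rZ;
            IAdd rQH rR rZ; IAdd rQT rR rZ; IStore rQT rZ;
            IAdd rQT rQT rONE; IStore rQT rONE; IAdd rQT rQT rONE;
            IStore rQT rN; IAdd rQT rQT rONE].

(** An equality test for a machine that only has [<]: the sum of the two truncated differences is
    positive iff the values differ. *)
Definition distance : seq instr :=
  [:: ISub rE rC rD; ISub rD rD rC; IAdd rD rD rE].

(** The end of a part is not stored. Beyond its start [p] all labels are at least [p], so a label
    below [p + 1] means being still inside; labels are rewritten only after this loop. *)
Definition partition_code : cmd :=
  While rT rP1 (seqs
    (Block ([:: IAdd rTJ rORD rJ; ILoad rY rTJ; IAdd rT rRS rY; ILoad rD rT]
            ++ distance))
    [:: If rZ rD (Block [::])
          (Block [:: IAdd rT rORD rM; ILoad rE rT; IStore rT rY; IStore rTJ rE;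
                     IAdd rM rM rONE]);
        Block [:: IAdd rJ rJ rONE; IAdd rT rLAB rJ; ILoad rT rT]]).

Definition relabel_code : cmd :=
  Seq (Block [:: IAdd rE rM rZ])
    (While rE rJ (Block [:: IAdd rT rLAB rE; IStore rT rM; IAdd rE rE rONE])).

(** Entered at the first position [i] that disagrees with the start [p] of its part: [[p, i)] is
    known to agree, so partitioning begins at [i]. *)
Definition split_code : cmd :=
  seqs (Block [:: IAdd rM rI rZ; IAdd rJ rI rONE; IAdd rP1 rP rONE;
                  IAdd rT rLAB rJ; ILoad rT rT])
    [:: partition_code; relabel_code;
        Block [:: IStore rQT rP; IAdd rQT rQT rONE; IStore rQT rM;
                  IAdd rQT rQT rONE; IStore rQT rJ; IAdd rQT rQT rONE]].

Definition scan_code : cmd :=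
  Seq (Block [:: IAdd rI rB0 rZ])
    (While rI rB1 (seqs
      (Block ([:: IAdd rT rLAB rI; ILoad rP rT; IAdd rT rORD rP; ILoad rT rT;
                  IAdd rT rRS rT; ILoad rC rT; IAdd rT rORD rI; ILoad rT rT;
                  IAdd rT rRS rT; ILoad rD rT] ++ distance))
      [:: If rZ rD split_code (Block [::]); Block [:: IAdd rI rI rONE]])).

Definition pass_code : cmd :=
  Seq (Block [:: IAdd rU rA0 rZ])
    (While rU rA1 (seqs
      (Block [:: IAdd rT rORD rU; ILoad rT rT; IAdd rT rROW rT; ILoad rRS rT])
      [:: scan_code; Block [:: IAdd rU rU rONE]])).

Definition main_code : cmd :=
  While rQH rQT (seqs
    (Block [:: ILoad rA0 rQH; IAdd rQH rQH rONE; ILoad rA1 rQH;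
               IAdd rQH rQH rONE; ILoad rB1 rQH; IAdd rQH rQH rONE;
               IAdd rB0 rA1 rZ])
    [:: pass_code;
        Block [:: IAdd rT rA0 rZ; IAdd rA0 rB0 rZ; IAdd rB0 rT rZ;
                  IAdd rT rA1 rZ; IAdd rA1 rB1 rZ; IAdd rB1 rT rZ];
        pass_code]).

(** All positions are visited for each part, which is linear per part and still quadratic overall.
    The length cell at [rH] is filled last. *)
Definition emit_code : cmd :=
  seqs (Block [:: IAdd rH rO rZ; IAdd rO rO rONE; IConst rJ 0])
    [:: While rJ rN (seqs
          (Block [:: IAdd rT rLAB rJ; ILoad rT rT; ISub rE rT rI; ISub rT rI rT;
                     IAdd rT rT rE])
          [:: If rZ rT (Block [::])
                (Block [:: IAdd rT rORD rJ; ILoad rT rT; IStore rO rT;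
                           IAdd rO rO rONE]);
              Block [:: IAdd rJ rJ rONE]]);
        Block [:: ISub rT rO rH; ISub rT rT rONE; IStore rH rT;
                  IAdd rCNT rCNT rONE]].

(** The queue is exhausted by now, so the memory from its tail on is free. Starting at 1 skips
    position 0, which holds [x]. *)
Definition output_code : cmd :=
  seqs (Block [:: IAdd rO rQT rONE; IConst rCNT 0; IConst rI 1])
    [:: While rI rN (seqs (Block [:: IAdd rT rLAB rI; ILoad rT rT])
          [:: If rT rI (Block [::]) emit_code; Block [:: IAdd rI rI rONE]]);
        Block [:: IStore rQT rCNT; IAdd 0 rQT rZ]].

Definition mhs_code : cmd :=
  seqs base_code [:: parse_code; start_code; main_code; output_code].

(** * Running the refinement *)

Definition frame (k : nat) (r r' : nat -> nat) : Prop :=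
  forall a, a < k -> r' a = r a.

Lemma frame_upd k r r' d v : k <= d -> frame k r r' -> frame k r (upd r' d v).
Proof. by move=> kd fr a ak; rewrite /upd; case: eqP => [|_]; [lia|exact: fr]. Qed.

Definition cells (items : seq item) : seq nat :=
  flatten [seq [:: it.1.1; it.1.2; it.2] | it <- items].

Lemma size_cells items : size (cells items) = 3 * size items.
Proof. by elim: items => //= it items IH; rewrite IH; lia. Qed.

Ltac block := eapply wp_block; [rewrite /=; try lia | rewrite ?/distance /=; calc].

Ltac frames := by do !apply: frame_upd => //.

Ltac parts := split=> //; try lia; try frames; try by reg.

Lemma swap_cells (f : nat -> nat) j k a :
  upd (upd f k (f j)) j (f k) a
  = f (if a == j then k else if a == k then j else a).
Proof. by rewrite /upd; do !case: eqP => // _. Qed.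

(** * Memory representation and amortized cost of the refinement *)

Section Program.

Variables (n x : nat) (cl : nat -> nat -> nat) (base : nat).

(* The diagonal of the class table is never filled. *)
Record Rep (m : nat -> nat) (qh : nat) (ord lab : nat -> nat)
    (items : seq item) : Prop := {
  rep_row : forall v, v < n -> m (base + v) = base + n + n + n.+1 + v * n;
  rep_ord : forall i, i < n -> m (base + n + i) = ord i;
  rep_lab : forall i, i <= n -> m (base + n + n + i) = lab i;
  rep_cl : forall v y, v < n -> y < n -> v <> y ->
    m (base + n + n + n.+1 + v * n + y) = cl v y;
  rep_queue : base + n + n + n.+1 + n * n <= qh;
  rep_items : lay m qh (cells items) }.

Lemma table_lt v y : v < n -> y < n -> v * n + y < n * n.
Proof. by move=> vn yn; have := leq_mul vn (leqnn n); rewrite mulSn; lia. Qed.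

Lemma Rep_store_ord m qh ord lab items j v a :
  a = base + n + j -> j < n -> Rep m qh ord lab items ->
  Rep (upd m a v) qh (upd ord j v) lab items.
Proof.
move=> -> jn [h1 h2 h3 h4 h5 h6]; split=> //.
- by move=> w wn; rewrite updN ?h1 //; lia.
- by move=> i inn; rewrite /upd eqn_add2l h2.
- by move=> i inn; rewrite updN ?h3 //; lia.
- by move=> w y wn yn wy; rewrite updN ?h4 //; lia.
- by apply: eq_lay h6 => i ri; rewrite updN //; lia.
Qed.

Lemma Rep_store_lab m qh ord lab items j v a :
  a = base + n + n + j -> j <= n -> Rep m qh ord lab items ->
  Rep (upd m a v) qh ord (upd lab j v) items.
Proof.
move=> -> jn [h1 h2 h3 h4 h5 h6]; split=> //.
- by move=> w wn; rewrite updN ?h1 //; lia.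
- by move=> i inn; rewrite updN ?h2 //; lia.
- by move=> i inn; rewrite /upd eqn_add2l h3.
- by move=> w y wn yn wy; rewrite updN ?h4 //; lia.
- by apply: eq_lay h6 => i ri; rewrite updN //; lia.
Qed.

Lemma Rep_store_above m qh ord lab items v a :
  qh + 3 * size items <= a -> Rep m qh ord lab items ->
  Rep (upd m a v) qh ord lab items.
Proof.
move=> ha [h1 h2 h3 h4 h5 h6]; have nn := leq0n (n * n); split=> //.
- by move=> w wn; rewrite updN ?h1 //; lia.
- by move=> i inn; rewrite updN ?h2 //; lia.
- by move=> i inn; rewrite updN ?h3 //; lia.
- by move=> w y wn yn wy; have tl := table_lt wn yn; rewrite updN ?h4 //; lia.
- by apply: eq_lay h6 => i; rewrite size_cells => ri; rewrite updN //; lia.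
Qed.

Lemma Rep_eq m qh ord lab ord' lab' items :
  (forall i, i < n -> ord i = ord' i) -> (forall i, i <= n -> lab i = lab' i) ->
  Rep m qh ord lab items -> Rep m qh ord' lab' items.
Proof.
move=> eo el [h1 h2 h3 h4 h5 h6]; split=> // i inn.
  by rewrite -eo ?h2.
by rewrite -el ?h3.
Qed.

Definition consts (r : nat -> nat) : Prop :=
  [/\ r rZ = 0, r rONE = 1, r rN = n, r rROW = base &
      r rORD = base + n /\ r rLAB = base + n + n].

Lemma consts_frame k r r' : 8 <= k -> frame k r r' -> consts r -> consts r'.
Proof. by move=> k8 f [h1 h2 h3 h4 [h5 h6]]; split; [| | | |split]; rewrite f //; lia. Qed.

Lemma wp_partition Q B r m qh ord lab items p i q u :
  consts r -> Rep m qh ord lab items ->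
  p < i -> i < q -> q <= n -> u < n -> ~~ (p <= u < q) ->
  (forall j, j < n -> ord j < n) ->
  (forall a b, a < n -> b < n -> ord a = ord b -> a = b) ->
  (forall j, i <= j -> j < q -> lab j = p) -> p < lab q ->
  r rRS = base + n + n + n.+1 + ord u * n ->
  (forall j, p <= j < i -> cl (ord u) (ord j) = r rC) ->
  cl (ord u) (ord i) <> r rC ->
  r rM = i -> r rJ = i.+1 -> r rP1 = p.+1 -> r rT = lab i.+1 ->
  20 * (q - i) <= B ->
  (forall B' r' m' ord' k, B <= B' + 20 * (q - i) -> frame 20 r r' ->
     Rep m' qh ord' lab items -> r' rM = k -> r' rJ = q -> i <= k -> k < q ->
    (forall j, j < n -> ord' j < n) ->
    (forall a b, a < n -> b < n -> ord' a = ord' b -> a = b) ->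
    (forall j, exists2 j', shuffled i q j j' & ord' j = ord j') ->
    (forall j, p <= j < k -> cl (ord u) (ord' j) = r rC) ->
    (forall j, k <= j < q -> cl (ord u) (ord' j) <> r rC) ->
    Q B' r' m') ->
  wp partition_code Q B r m.
Proof.
move=> cst rep pi iq qn un nu ltn' inj' labq lq rs agree ne rm rj rp1 rt hB K.
(* [[p, k)] agrees, [[k, j)] disagrees, positions from [j] on are untouched. Position [i] counts as
   disagreeing from the start, so [k < j] throughout and the right side is nonempty. *)
apply: (wp_while (I := fun B' r' m' => exists ord' k j,
  [/\ [/\ B <= B' + 20 * (j - i.+1), 20 * (q - j) + 20 <= B', frame 20 r r',
        Rep m' qh ord' lab items & r' rT = lab j],
   [/\ r' rM = k, r' rJ = j, i <= k, k < j & j <= q],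
   (forall j, j < n -> ord' j < n) /\
    (forall a b, a < n -> b < n -> ord' a = ord' b -> a = b) &
   [/\ (forall j', j <= j' -> ord' j' = ord j'),
    (forall j, exists2 j', shuffled i q j j' & ord' j = ord j'),
    (forall j, p <= j < k -> cl (ord u) (ord' j) = r rC) &
    (forall j', k <= j' < j -> cl (ord u) (ord' j') <> r rC)]])).
- exists ord, i, i.+1; split.
  + by split=> //; lia.
  + by split=> //; lia.
  + by [].
  + split=> //; first by move=> j; exists j => //; left.
    by move=> j' hj'; have -> : j' = i by lia.
- by move=> B' r' m' [o [k [j [[b1 b2 _ _ _] _ _ _]]]]; lia.
- move=> B' r' m' [o [k [j [[b1 b2 fr rep' rt'] [rm' rj' ik kj jq] [olt oinj] [okeep osh oag one]]]]].
  rewrite (fr rP1 isT) rp1 rt' => lj.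
  have jq' : j < q.
    rewrite ltn_neqAle jq andbT; apply/eqP => e; move: lj; rewrite e; lia.
  have [c1 c2 c3 c4 [c5 c6]] := consts_frame (k := 20) isT fr cst.
  have c7 : r' rRS = base + n + n + n.+1 + ord u * n by rewrite fr.
  have c8 : r' rC = r rC by apply: fr.
  (* The diagonal of the class table is undefined, so a lookup requires two distinct vertices. *)
  have uj : ord u <> o j.
    rewrite okeep // => e; move: nu; rewrite (inj' _ _ un _ e); lia.
  apply: wp_seq; block.
  load (rep_ord rep' (leq_trans jq' qn)).
  load (rep_cl rep' (ltn' _ un) (olt _ (leq_trans jq' qn)) uj).
  apply: wp_seq; eapply wp_if; [look|look|lia| |].
  + move=> hd; block.
    block. load (rep_lab rep' (leq_trans jq' qn)).
    exists o, k, j.+1; split.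
    * parts.
    * parts.
    * by [].
    * split=> //; first by move=> j' hj'; apply: okeep; lia.
      move=> j' hj'; have [->|nj] := eqVneq j' j; first by lia.
      by apply: one; lia.
  + move=> hd; block.
    have kn : k < n by lia.
    load (rep_ord rep' kn).
    have jn : j < n by lia.
    have rep1 := Rep_store_ord (o j) (erefl _) kn rep'.
    have rep2 := Rep_store_ord (o k) (erefl _) jn rep1.
    block. load (rep_lab rep2 jn).
    exists (upd (upd o k (o j)) j (o k)), k.+1, j.+1; split.
    * parts.
    * parts.
    * by split=> [a an|a b an bn]; rewrite !swap_cells; [|move/oinj];
        do !case: eqP => ? //; try lia; auto.
    * split=> //.
      - by move=> a ja; rewrite swap_cells !ifF ?okeep //; lia.
      - move=> a; rewrite swap_cells.
        have [->|na] := eqVneq a j; last have [->|na'] := eqVneq a k; last exact: osh.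
          by have [k' sh ->] := osh k; exists k' => //; right; case: sh => [<-|]; lia.
        by have [k' sh ->] := osh j; exists k' => //; right; case: sh => [<-|]; lia.
      - move=> a ra; rewrite swap_cells.
        have [?|na] := eqVneq a j; first by lia.
        by have [?|na'] := eqVneq a k; [lia|apply: oag; lia].
      - move=> a ra; rewrite swap_cells.
        have [?|na] := eqVneq a j; first by apply: one; lia.
        by have [?|na'] := eqVneq a k; [lia|apply: one; lia].
- move=> B' r' m' [o [k [j [[b1 b2 fr rep' rt'] [rm' rj' ik kj jq] [olt oinj] [okeep osh oag one]]]]].
  rewrite (fr rP1 isT) rp1 rt' => lj.
  have e : j = q by apply/eqP; rewrite eqn_leq jq leqNgt; apply/negP => /labq; lia.
  by rewrite e in b1 rj' kj one; apply: (K _ _ _ o k) => //; lia.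
Qed.
Lemma wp_relabel Q B r m qh ord lab items k q :
  consts r -> Rep m qh ord lab items -> k <= q -> q <= n ->
  r rM = k -> r rJ = q -> 5 * (q - k) + 5 <= B ->
  (forall B' r' m', B <= B' + 5 * (q - k) + 5 -> frame 22 r r' ->
     Rep m' qh ord (relabel lab k q) items -> Q B' r' m') ->
  wp relabel_code Q B r m.
Proof.
move=> cst rep kq qn rm rj hB K.
have [c1 c2 c3 c4 [c5 c6]] := cst.
apply: wp_seq; block; rewrite addn0.
apply: (wp_while (I := fun B' r' m' => exists e,
  [/\ [/\ r' rE = e, k <= e & e <= q], frame 22 r r',
   Rep m' qh ord (relabel lab k e) items,
   B <= B' + 1 + 5 * (e - k) & 5 * (q - e) + 4 <= B'])).
- exists k; split=> //; try lia; try frames.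
  apply: (Rep_eq _ _ rep) => // i _.
  by rewrite /relabel ifF //; lia.
- by move=> B' r' m' [e [_ _ _ _]]; lia.
- move=> B' r' m' [e [[re ke eq] fr rep' b1 b2]].
  rewrite re (fr rJ isT) rj => lt.
  have [d1 d2 d3 d4 [d5 d6]] := consts_frame (k := 22) isT fr cst.
  have d7 : r' rM = k by rewrite fr.
  block; exists e.+1; split; [parts|frames| |lia|lia].
  have := Rep_store_lab k (erefl _) (leq_trans (ltnW lt) qn) rep'.
  apply: Rep_eq => // i _; rewrite /upd /relabel.
  by case: eqP => [->|ne]; [rewrite ifT //; lia|congr (if _ then _ else _); lia].
- move=> B' r' m' [e [[re ke eq] fr rep' b1 b2]].
  rewrite re (fr rJ isT) rj => ge.
  have e_q : e = q by lia.
  by rewrite e_q in b1 rep'; apply: K => //; lia.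
Qed.

(** The end is the least position after the start with another label; the sentinel [lab n = n]
    ensures that there is one. *)
Lemma part_end lab i :
  (forall i, i <= n -> lab i <= i) -> (forall i, i <= n -> lab (lab i) = lab i) ->
  (forall i j, i <= j -> j <= n -> lab i <= lab j) -> lab n = n -> i < n ->
  exists q, [/\ i < q, q <= n &
    forall j, j <= n -> (lab j == lab i) = (lab i <= j < q)].
Proof.
move=> le idp mono ln lin.
have lii := le _ (ltnW lin).
have ex : exists j, (lab i < j) && (lab j != lab i).
  by exists n; rewrite ln; lia.
have [q /andP [iq nq] qmin] := ex_minnP ex.
have qn : q <= n by apply: qmin; rewrite ln; lia.
have labq j : j <= n -> lab j = lab i -> j < q.
  move=> jn e; rewrite ltnNge; apply/negP => qj.
  have := mono _ _ qj jn; have := mono _ _ (ltnW iq) qn; rewrite idp; lia.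
exists q; split=> //; first by apply: labq => //; lia.
move=> j jn; apply/eqP/idP => [e|/andP [ij jq]].
  by rewrite labq // -e le.
have [->|nj] := eqVneq j (lab i); first by rewrite idp; lia.
apply/eqP/negPn/negP => nl.
by have := qmin j; rewrite nl andbT ltn_neqAle eq_sym nj ij; lia.
Qed.

(* Locked, to keep unification from computing with the unary constants. *)
Definition potential (lab : nat -> nat) (items : seq item) : nat :=
  locked (200 * work items + 300 * same_part_pairs n lab).

Lemma Rep_push m qh ord lab items p k q a :
  a = qh + 3 * size items -> Rep m qh ord lab items ->
  Rep (upd (upd (upd m a p) a.+1 k) a.+2 q) qh ord lab (rcons items (p, k, q)).
Proof.
move=> ea rep.
have [] : Rep (upd (upd (upd m a p) a.+1 k) a.+2 q) qh ord lab items.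
  by do !(apply: Rep_store_above => //; try lia).
move=> h1 h2 h3 h4 h5 h6; split=> //.
rewrite /cells map_rcons flatten_rcons; apply/lay_cat; split=> //.
rewrite size_cells -ea /=; do !split=> //; by rewrite /upd; do !case: eqP; lia.
Qed.

(** The only budget asked for is the potential, and its fall pays for the cut. On return position
    [i] agrees with the start of its new part, so the scan can move on. *)
Lemma wp_split Q B r m ord lab items rest u i :
  consts r -> Rep m (r rQH) ord lab items -> r rQT = r rQH + 3 * size items ->
  Inv n x cl ord lab items rest ->
  i < n -> u < n -> lab u <> lab i ->
  r rI = i -> r rP = lab i -> r rRS = base + n + n + n.+1 + ord u * n ->
  r rC = cl (ord u) (ord (lab i)) ->
  (forall j, lab i <= j < i -> cl (ord u) (ord j) = cl (ord u) (ord (lab i))) ->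
  cl (ord u) (ord i) <> cl (ord u) (ord (lab i)) ->
  (forall q, i < q -> q <= n ->
     (forall j, j <= n -> (lab j == lab i) = (lab i <= j < q)) ->
     forall v a v' a', rest v' a' -> shuffled (lab i) q v v' ->
       shuffled (lab i) q a a' -> rest v a) ->
  potential lab items <= B ->
  (forall B' r' m' ord' lab' items', frame 18 r r' ->
     Rep m' (r rQH) ord' lab' items' -> r' rQT = r rQH + 3 * size items' ->
     Inv n x cl ord' lab' items' rest ->
     B + potential lab' items' <= B' + potential lab items ->
     (forall j, lab j = j -> lab' j = j) ->
     (forall j, j < i -> ord' j = ord j /\ lab' j = lab j) ->
     (forall j, j < n -> lab j <> lab i -> ord' j = ord j) ->
     cl (ord u) (ord' i) = cl (ord u) (ord' (lab' i)) ->
     Q B' r' m') ->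
  wp split_code Q B r m.
Proof.
move=> cst rep qt I lin lun lui ri rp rs rc agree ne stab hB K.
have [c1 c2 c3 c4 [c5 c6]] := cst.
have [q [iq qn part]] := part_end (lab_le I) (lab_id I) (lab_mono I) (labn I) lin.
have := lab_le I (ltnW lin); set p := lab i in part rp rc agree ne stab K lui *.
move=> lep.
have pi : p < i by rewrite ltn_neqAle lep andbT; apply/eqP => e; case: ne; rewrite e.
have spart j : p <= j < q -> lab j = p by move=> h; apply/eqP; rewrite part; lia.
have lq : p < lab q.
  have : lab q != p by rewrite part // ltnn andbF.
  have : p <= lab q by apply: (lab_mono I) => //; exact: ltnW.
  lia.
(* The final boundary [k] is not known yet; a fictitious cut at [i] already shows that the potential
   covers the partition loop. *)
have [B1 B2] : 200 * (q - i) <= B /\ 30 <= B.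
  have := same_part_pairs_relabel (ltnW pi) (ltnW iq) qn
    (fun j h => spart j (introT andP (conj (leq_trans lep (proj1 (andP h))) (proj2 (andP h))))).
  move: hB; rewrite /potential -lock.
  have : q - i <= (i - p) * (q - i) by rewrite leq_pmull // subn_gt0.
  lia.
rewrite /split_code /=; apply: wp_seq; block.
load (rep_lab rep (leq_trans iq qn)).
apply: wp_seq.
set r1 := (X in wp _ _ _ X _).
have fr1 : frame 18 r r1 by frames.
have [rs1 rc1] : r1 rRS = r rRS /\ r1 rC = r rC by [].
have [m1 j1 p1 t1] : [/\ r1 rM = i, r1 rJ = i.+1, r1 rP1 = p.+1 & r1 rT = lab i.+1] by rewrite /r1; parts.
have qt1 : r1 rQT = r rQT by [].
have cst1 := consts_frame (k := 18) isT fr1 cst.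
move: (r1) fr1 rs1 rc1 m1 j1 p1 t1 qt1 cst1 => {}r1 fr1 rs1 rc1 m1 j1 p1 t1 qt1 cst1.
apply: (wp_partition (p := p) (i := i) (q := q) (u := u) cst1 rep pi iq qn lun _
  (ord_lt I) (ord_injective I)); rewrite ?rs1 ?rc1 //; try lia.
- by move: (part u (ltnW lun)) => <-; apply/eqP.
- by move=> j ij jq; apply: spart; lia.
- by move=> j h; rewrite agree.
move=> B' r2 m' ord' k b' fr2 rep' rm rj ik kq olt oinj osh oag odis.
have cst2 := consts_frame (k := 20) isT fr2 cst1.
have pp : p <= k < q by lia.
have pairs : same_part_pairs n lab
    = same_part_pairs n (relabel lab k q) + (k - p) * (q - k).
  by apply: same_part_pairs_relabel => //; try lia; move=> j h; apply: spart; lia.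
(* Both sides are nonempty, so the separated pairs bound the length of the part, and 100 units per
   pair pay for the cut. *)
have ab : q - p <= 2 * ((k - p) * (q - k)) by nia.
move: hB; rewrite /potential -!lock pairs => hB.
apply: wp_seq; apply: (wp_relabel (k := k) (q := q) cst2 rep') => //; try lia.
move=> B'' r3 m3 b'' fr3 rep3.
have [d1 d2 d3 d4 [d5 d6]] := consts_frame (k := 22) isT fr3 cst2.
have p3 : r3 rP = p by rewrite fr3 // fr2 // fr1.
have qt3 : r3 rQT = r rQT by rewrite fr3 // fr2 // qt1.
have m3' : r3 rM = k by rewrite fr3.
have j3 : r3 rJ = q by rewrite fr3.
block.
have osh' j : exists2 j', shuffled p q j j' & ord' j = ord j'.
  by have [j' sh e] := osh j; exists j' => //; case: sh => [->|h]; [left|right; lia].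
have nu : ~~ (p <= u < q) by move: (part u (ltnW lun)) => <-; apply/eqP.
apply: (K _ _ _ ord' (relabel lab k q) (rcons items (p, k, q))).
- by do !apply: frame_upd => //; move=> a ha; rewrite fr3 ?fr2 ?fr1 //; lia.
- by rewrite !addn1; apply: Rep_push rep3; rewrite qt.
- by rewrite size_rcons /=; reg.
- apply: (Inv_split (u := u) I) => //; try lia.
  + by move=> a b ha hb; rewrite oag; [apply/nesym/odis|]; lia.
  + exact: stab iq qn part.
- rewrite /potential -!lock pairs work_rcons /=; lia.
- by move=> j lj; rewrite /relabel ifF //; apply/negP => h; have := spart j; lia.
- move=> j ji; rewrite /relabel ifF; last lia; split=> //.
  by have [j' + ->] := osh j; case=> [->|]; [|lia].
- move=> j jn lj; have [j' + ->] := osh' j; case=> [->//|].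
  by have := spart j; lia.
(* If [k = i], position [i] starts the new part; otherwise [i < k] and it has received a vertex that
   agrees with the start [p]. *)
- rewrite /relabel; have [<-|nk] := eqVneq k i; first by rewrite leqnn kq.
  by rewrite ifF; [rewrite !oag // -?/p; lia|lia].
Qed.
Record sides (lab : nat -> nat) (a0 a1 b0 b1 : nat) : Prop := {
  sidesA : a0 < a1 <= n;
  sidesB : b0 < b1 <= n;
  sides_disjoint : (a1 <= b0) || (b1 <= a0);
  sides_lab : [/\ lab a0 = a0, lab a1 = a1, lab b0 = b0 & lab b1 = b1] }.

Lemma sides_sym lab a0 a1 b0 b1 : sides lab a0 a1 b0 b1 -> sides lab b0 b1 a0 a1.
Proof. by case=> ? ? d [? ? ? ?]; split=> //; rewrite orbC. Qed.

(* What remains to be compared when the positions of [a0, u) have been compared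
   with [b0, b1); [f] tells whether the converse comparison is still due. *)
Definition todo (f : bool) (a0 a1 b0 b1 u v i : nat) : bool :=
  (u <= v < a1) && (b0 <= i < b1) || [&& f, b0 <= v < b1 & a0 <= i < a1].

(** A shuffle inside [[b0, b1)] moves no position of the other side and keeps membership in
    [[b0, b1)]. *)
Lemma todo_shuffled f a0 a1 b0 b1 u p q :
  a0 <= u -> (a1 <= b0) || (b1 <= a0) -> b0 <= p -> q <= b1 ->
  forall v a v' a', todo f a0 a1 b0 b1 u v' a' -> shuffled p q v v' ->
    shuffled p q a a' -> todo f a0 a1 b0 b1 u v a.
Proof.
rewrite /todo => au dj bp qb v a v' a' h [->|hv] [->|ha]; move: h; case: f => /=; lia.
Qed.

(** The loop maintains that positions before [i] agree with the start of their part. Cuts preserve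
    this, as they neither move nor relabel those positions; at the end [ord u] is constant on every
    part of [[b0, b1)]. [K] is budget kept for the caller. *)
Lemma wp_scan Q B r m ord lab items f a0 a1 b0 b1 u K :
  consts r -> Rep m (r rQH) ord lab items -> r rQT = r rQH + 3 * size items ->
  Inv n x cl ord lab items (todo f a0 a1 b0 b1 u) ->
  sides lab a0 a1 b0 b1 -> a0 <= u < a1 -> r rB0 = b0 -> r rB1 = b1 ->
  r rRS = base + n + n + n.+1 + ord u * n ->
  K + 30 * (b1 - b0) + 10 + potential lab items <= B ->
  (forall B' r' m' ord' lab' items', frame 15 r r' ->
     Rep m' (r rQH) ord' lab' items' -> r' rQT = r rQH + 3 * size items' ->
     Inv n x cl ord' lab' items' (todo f a0 a1 b0 b1 u.+1) ->
     sides lab' a0 a1 b0 b1 -> K + potential lab' items' <= B' -> Q B' r' m') ->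
  wp scan_code Q B r m.
Proof.
move=> cst rep qt I sd uA rb0 rb1 rs hB HK.
have [c1 c2 c3 c4 [c5 c6]] := cst.
rewrite /scan_code /=; apply: wp_seq; block; rewrite addn0.
apply: (wp_while (I := fun B' r' m' => exists ord' lab' items' i,
  [/\ [/\ frame 15 r r', Rep m' (r rQH) ord' lab' items',
         r' rQT = r rQH + 3 * size items' &
         Inv n x cl ord' lab' items' (todo f a0 a1 b0 b1 u)],
       [/\ sides lab' a0 a1 b0 b1, r' rI = i, b0 <= i & i <= b1],
       r rRS = base + n + n + n.+1 + ord' u * n,
       (forall j, b0 <= j < i ->
          cl (ord' u) (ord' j) = cl (ord' u) (ord' (lab' j))) &
       K + 30 * (b1 - i) + 5 + potential lab' items' <= B'])).
- exists ord, lab, items, b0; have [sA sB _ _] := sd; split.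
  + by split=> //; frames.
  + by split=> //; lia.
  + by [].
  + by move=> j; lia.
  + by lia.
- by move=> B' r' m' [o [l [its [i [_ _ _ _]]]]]; lia.
- move=> {ord lab items rep qt I sd rs hB} B' r' m'.
  move=> [o [l [its [i [[fr rep qt I] [sd ri bi _] rs done hB]]]]].
  rewrite ri (fr rB1 isT) rb1 => ib.
  have [d1 d2 d3 d4 [d5 d6]] := consts_frame (k := 15) isT fr cst.
  have [sA sB dj [la0 la1 lb0 lb1]] := sd.
  have inn : i < n by lia.
  have un : u < n by lia.
  have li := lab_le I (ltnW inn).
  have bl : b0 <= l i by rewrite -lb0; apply: (lab_mono I) => //; exact: ltnW.
  have rs' : r' rRS = base + n + n + n.+1 + o u * n by rewrite fr.
  have qh' : r' rQH = r rQH by rewrite fr.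
  have bd := below_boundary (lab_mono I) (lab_le I).
  have lui : l u <> l i.
    move=> e; case/orP: dj => dj.
      by have := bd u i b0 _ lb0 (ltnW un) (ltnW inn) e; lia.
    by have := bd i u b1 _ lb1 (ltnW inn) (ltnW un) (esym e); lia.
  have lin : l i < n by lia.
  have oul : o u <> o (l i).
    by move/(ord_injective I un lin) => e; apply: lui; rewrite e (lab_id I) // ltnW.
  have oui : o u <> o i.
    by move/(ord_injective I un inn) => e; apply: lui; rewrite e.
  apply: wp_seq; block.
  load (rep_lab rep (ltnW inn)).
  load (rep_ord rep lin).
  load (rep_cl rep (ord_lt I un) (ord_lt I lin) oul).
  load (rep_ord rep inn).
  load (rep_cl rep (ord_lt I un) (ord_lt I inn) oui).
  set r1 := (X in wp _ _ _ X _).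
  have fr1 : frame 15 r r1 by frames.
  have [e1 e2 e3 e4] : [/\ r1 rI = i, r1 rP = l i, r1 rC = cl (o u) (o (l i))
     & r1 rD = cl (o u) (o i) - cl (o u) (o (l i))
             + (cl (o u) (o (l i)) - cl (o u) (o i))].
    by rewrite /r1; split; look.
  move: (r1) fr1 e1 e2 e3 e4 (erefl : r1 rQT = r' rQT) => {}r1 fr1 e1 e2 e3 e4 qt1.
  have e5 : r1 rRS = base + n + n + n.+1 + o u * n by rewrite fr1.
  have cst1 := consts_frame (k := 15) isT fr1 cst.
  have e6 : r1 rQH = r rQH by rewrite fr1.
  have [f1 f2 _ _ _] := cst1.
  apply: wp_seq; apply: (wp_if f1 e4); first by lia.
  - move=> ne; rewrite -e6 in rep.
    apply: (wp_split (u := u) (i := i) cst1 rep _ I) => //.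
    + by rewrite qt1 qt e6.
    + move=> j hj.
      have jn : j <= n by lia.
      have lj : l j = l i.
        have := lab_mono I (proj1 (andP hj)) jn; rewrite (lab_id I (ltnW inn)).
        by have := lab_mono I (ltnW (proj2 (andP hj))) (ltnW inn); lia.
      by rewrite done ?lj //; lia.
    + by lia.
    + move=> q iq qn part; apply: todo_shuffled => //; first by lia.
      have lq : l q.-1 = l i by apply/eqP; rewrite part; lia.
      have q1n : q.-1 <= n by lia.
      by have := bd _ _ b1 _ lb1 (ltnW inn) q1n (esym lq); lia.
    + by lia.
    + move=> B2 r2 m2 o2 l2 its2 fr2 rep2 qt2 I2 hB2 lkeep before away ei.
      have o2u : o2 u = o u by apply: away.
      have g : r2 rI = i by rewrite fr2.
      have g2 : r2 rONE = 1 by rewrite fr2.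
      block; exists o2, l2, its2, i.+1; split.
      * split.
        - by apply: frame_upd => //; move=> a ha; rewrite fr2 ?fr1 ?fr //; lia.
        - by rewrite -e6.
        - by rewrite -e6; reg.
        - by [].
      * by split; [split=> //; split; exact: lkeep|reg|lia|lia].
      * by rewrite o2u.
      * move=> j hj; rewrite o2u; have [->|nj] := eqVneq j i; first by [].
        have ji : j < i by lia.
        have [-> ->] := before j ji.
        have lji : l j < i by have := lab_le I (ltnW (ltn_trans ji inn)); lia.
        by have [-> _] := before _ lji; apply: done; lia.
      * by lia.
  - move=> eq0; block; block.
    exists o, l, its, i.+1; split.
    + split=> //; last by reg.
      by apply: frame_upd => //; move=> a ha; rewrite fr1 ?fr.
    + by split; [|reg|lia|lia].
    + by [].
    + move=> j hj; have [->|nj] := eqVneq j i; first by lia.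
      by apply: done; lia.
    + by lia.
- move=> {ord lab items rep qt I sd rs hB} B' r' m'.
  move=> [o [l [its [i [[fr rep qt I] [sd ri bi ib] rs done hB]]]]].
  rewrite ri (fr rB1 isT) rb1 => ge.
  have {ge ib} ei : i = b1 by lia.
  rewrite {i bi ri}ei in done hB.
  apply: (HK _ _ _ _ _ _ fr rep qt _ sd); last by lia.
  apply: (Inv_weaken I (items_ok I)) => v a j vn an jn laj lva np nt.
  rewrite (negbTE np) /= => td.
  (* The debt cleared by the scan is the comparison of [u] alone with [[b0, b1)]. *)
  have [-> ra] : v = u /\ b0 <= a < b1 by move: td nt; rewrite /todo; lia.
  have [_ sB _ [_ _ lb0 lb1]] := sd.
  have bd := below_boundary (lab_mono I) (lab_le I).
  have rj : b0 <= j < b1.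
    have := bd j a b0 _ lb0 (ltnW jn) (ltnW an) (esym laj).
    by have := bd a j b1 _ lb1 (ltnW an) (ltnW jn) laj; lia.
  by rewrite (done a ra) (done j rj) laj.
Qed.
Lemma wp_pass Q B r m ord lab items f a0 a1 b0 b1 K :
  consts r -> Rep m (r rQH) ord lab items -> r rQT = r rQH + 3 * size items ->
  Inv n x cl ord lab items (todo f a0 a1 b0 b1 a0) ->
  sides lab a0 a1 b0 b1 ->
  [/\ r rA0 = a0, r rA1 = a1, r rB0 = b0 & r rB1 = b1] ->
  K + (a1 - a0) * (30 * (b1 - b0) + 30) + 10 + potential lab items <= B ->
  (forall B' r' m' ord' lab' items', frame 13 r r' ->
     Rep m' (r rQH) ord' lab' items' -> r' rQT = r rQH + 3 * size items' ->
     Inv n x cl ord' lab' items' (todo f a0 a1 b0 b1 a1) ->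
     sides lab' a0 a1 b0 b1 -> K + potential lab' items' <= B' -> Q B' r' m') ->
  wp pass_code Q B r m.
Proof.
move=> cst rep qt I sd [ra0 ra1 rb0 rb1] hB HK.
have nn k : 0 <= (a1 - k) * (30 * (b1 - b0) + 30) by [].
have nn0 := nn a0.
have [c1 c2 c3 c4 [c5 c6]] := cst.
rewrite /pass_code /=; apply: wp_seq; block; rewrite addn0.
apply: (wp_while (I := fun B' r' m' => exists ord' lab' items' u,
  [/\ [/\ frame 13 r r', Rep m' (r rQH) ord' lab' items',
         r' rQT = r rQH + 3 * size items' &
         Inv n x cl ord' lab' items' (todo f a0 a1 b0 b1 u)],
       [/\ sides lab' a0 a1 b0 b1, r' rU = u, a0 <= u & u <= a1] &
       K + (a1 - u) * (30 * (b1 - b0) + 30) + 5 + potential lab' items' <= B'])).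
- exists ord, lab, items, a0; have [sA sB _ _] := sd; split.
  + by split=> //; frames.
  + by split=> //; lia.
  + by lia.
- by move=> B' r' m' [o [l [its [u [_ _]]]]]; have := nn u; lia.
- move=> {ord lab items rep qt I sd hB} B' r' m'.
  move=> [o [l [its [u [[fr rep qt I] [sd ru au _] hB]]]]].
  rewrite ru (fr rA1 isT) ra1 => ua.
  have [d1 d2 d3 d4 [d5 d6]] := consts_frame (k := 13) isT fr cst.
  have [sA sB dj _] := sd.
  have un : u < n by lia.
  have cost : (a1 - u) * (30 * (b1 - b0) + 30)
      = (a1 - u.+1) * (30 * (b1 - b0) + 30) + 30 * (b1 - b0) + 30.
    by rewrite -{1}(subnSK ua) mulSn; lia.
  have nnu := nn u.+1.
  apply: wp_seq; block.
  load (rep_ord rep un).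
  load (rep_row rep (ord_lt I un)).
  set r1 := (X in wp _ _ _ X _).
  have fr1 : frame 13 r r1 by frames.
  have [e1 e2] : r1 rU = u /\ r1 rRS = base + n + n + n.+1 + o u * n.
    by rewrite /r1; split; look.
  move: (r1) fr1 e1 e2 (erefl : r1 rQT = r' rQT) => {}r1 fr1 e1 e2 qt1.
  have cst1 := consts_frame (k := 13) isT fr1 cst.
  have e6 : r1 rQH = r rQH by rewrite fr1.
  rewrite -e6 in rep.
  apply: wp_seq.
  apply: (wp_scan (u := u) (a0 := a0) (b0 := b0) (K :=
    K + (a1 - u.+1) * (30 * (b1 - b0) + 30) + 10) cst1 rep _ I sd).
  + by rewrite qt1 qt e6.
  + by lia.
  + by rewrite fr1.
  + by rewrite fr1.
  + by [].
  + by lia.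
  + move=> B2 r2 m2 o2 l2 its2 fr2 rep2 qt2 I2 sd2 hB2.
    have g : r2 rU = u by rewrite fr2.
    have g2 : r2 rONE = 1 by rewrite fr2 // fr1.
    block; exists o2, l2, its2, u.+1; split.
    * split; [|by rewrite -e6|by rewrite -e6; reg|by []].
      by apply: frame_upd => //; move=> a ha; rewrite fr2 ?fr1 //; lia.
    * by split=> //; [reg|lia].
    * by lia.
- move=> {ord lab items rep qt I sd hB} B' r' m'.
  move=> [o [l [its [u [[fr rep qt I] [sd ru au ua] hB]]]]].
  rewrite ru (fr rA1 isT) ra1 => ge.
  have {ge ua} eu : u = a1 by lia.
  rewrite eu in I.
  by apply: (HK _ _ _ _ _ _ fr rep qt I sd); lia.
Qed.

Lemma wp_main Q B r m ord lab items K :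
  consts r -> Rep m (r rQH) ord lab items -> r rQT = r rQH + 3 * size items ->
  Inv n x cl ord lab items (fun _ _ => false) ->
  K + 2 + potential lab items <= B ->
  (forall B' r' m' ord' lab', frame 8 r r' ->
     Rep m' (r' rQH) ord' lab' [::] -> r' rQT = r' rQH ->
     Inv n x cl ord' lab' [::] (fun _ _ => false) -> K <= B' -> Q B' r' m') ->
  wp main_code Q B r m.
Proof.
move=> cst rep qt I hB HK.
apply: (wp_while (I := fun B' r' m' => exists ord' lab' items',
  [/\ frame 8 r r', Rep m' (r' rQH) ord' lab' items',
       r' rQT = r' rQH + 3 * size items',
       Inv n x cl ord' lab' items' (fun _ _ => false) &
       K + 2 + potential lab' items' <= B'])).
- by exists ord, lab, items.
- by move=> B' r' m' [o [l [its [_ _ _ _]]]]; lia.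
- move=> {ord lab items rep qt I hB} B' r' m' [o [l [its [fr rep qt I hB]]]] lt.
  have {lt} : 0 < size its by lia.
  case: its rep qt I hB => // -[[a b] c] its rep qt I hB _.
  have /= /andP [/and5P [ab bc cn /eqP la /andP [/eqP lb /eqP lc]] ok] := items_ok I.
  have [d1 d2 d3 d4 [d5 d6]] := consts_frame (k := 8) isT fr cst.
  have /= [i1 [i2 [i3 i4]]] := rep_items rep.
  have cost : (b - a) * (30 * (c - b) + 30) + (c - b) * (30 * (b - a) + 30) + 50
     <= 200 * ((b - a) * (c - b)).
    by nia.
  have pot : potential l ((a, b, c) :: its) = 200 * ((b - a) * (c - b)) + potential l its.
    by rewrite /potential -!lock /work /=; lia.
  have nn1 := leq0n ((b - a) * (30 * (c - b) + 30)).
  have nn2 := leq0n ((c - b) * (30 * (b - a) + 30)).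
  rewrite pot in hB.
  apply: wp_seq; block.
  load i1.
  load i2.
  load i3.
  set r1 := (X in wp _ _ _ X _).
  have fr1 : frame 8 r r1 by frames.
  have [[e1 e2 e3 e4] e5 e6] : [/\ [/\ r1 rA0 = a, r1 rA1 = b, r1 rB0 = b & r1 rB1 = c],
      r1 rQH = (r' rQH).+3 & r1 rQT = (r' rQH).+3 + 3 * size its].
    by rewrite /r1; split; [split; reg|reg|etransitivity; [look|rewrite /=; lia]].
  rewrite -e5 in e6.
  move: (r1) fr1 e1 e2 e3 e4 e5 e6 => {}r1 fr1 e1 e2 e3 e4 e5 e6.
  have cst1 := consts_frame (k := 8) isT fr1 cst.
  have rep1 : Rep m' (r1 rQH) o l its.
    by case: rep => *; split=> //; rewrite e5 //; lia.
  (* Taking the triple off the queue turns its pending pairs, in both directions, into the debt of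
     the two passes. *)
  have I1 : Inv n x cl o l its (todo true a b b c a).
    apply: (Inv_weaken I ok) => v i j _ _ _ _ _ np nt.
    by rewrite /= (negbTE np) !orbF; move: nt; rewrite /todo; lia.
  have sd : sides l a b b c by split=> //; lia.
  apply: wp_seq.
  apply: (wp_pass (K := K + (c - b) * (30 * (b - a) + 30) + 25) cst1 rep1 e6 I1 sd) => //.
    by lia.
  move=> {o l its rep I hB ok qt la lb lc pot I1 sd rep1 e6 i4} B2 r2 m2 o l its fr2 rep qt I sd hB.
  have [f1 f2 f3 f4 f5] : [/\ r2 rA0 = a, r2 rA1 = b, r2 rB0 = b, r2 rB1 = c & r2 rZ = 0].
    by have [k1 _ _ _ _] := cst1; split; rewrite fr2.
  apply: wp_seq; block; rewrite !addn0.
  set r3 := (X in wp _ _ _ X _).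
  have fr3 : frame 8 r r3 by do !apply: frame_upd => //; move=> k hk; rewrite fr2 ?fr1 //; lia.
  have [[g1 g2 g3 g4] g5 g6] : [/\ [/\ r3 rA0 = b, r3 rA1 = c, r3 rB0 = a & r3 rB1 = b],
      r3 rQH = r1 rQH & r3 rQT = r3 rQH + 3 * size its].
    have h : r3 rQH = r1 rQH by rewrite /r3; etransitivity; [look|rewrite fr2].
    by rewrite h; split=> //.
  move: (r3) fr3 g1 g2 g3 g4 g5 g6 => {}r3 fr3 g1 g2 g3 g4 g5 g6.
  have cst3 := consts_frame (k := 8) isT fr3 cst.
  rewrite -g5 in rep.
  (* The converse left over by the first pass is the whole debt of the second, with the sides
     exchanged. *)
  have I2 : Inv n x cl o l its (todo false b c a b b).
    apply: (Inv_weaken I (items_ok I)) => v i j _ _ _ _ _ np nt.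
    by rewrite /= (negbTE np); move: nt; rewrite /todo; lia.
  apply: (wp_pass (K := K + 2) cst3 rep g6 I2 (sides_sym sd)) => //.
    by lia.
  move=> {o l its rep I hB qt sd g6 I2} B4 r4 m4 o l its fr4 rep qt I sd hB.
  have h : r4 rQH = r3 rQH by rewrite fr4.
  exists o, l, its; split; rewrite ?h //.
    by move=> k hk; rewrite fr4 ?fr3 //; lia.
  apply: (Inv_weaken I (items_ok I)) => v i j _ _ _ _ _ np nt.
  by rewrite /= (negbTE np); move: nt; rewrite /todo; lia.
- move=> {ord lab items rep qt I hB} B' r' m' [o [l [its [fr rep qt I hB]]]] ge.
  have {ge} : size its = 0 by lia.
  case: its rep qt I hB => // rep qt I hB _.
  rewrite /= addn0 in qt.
  by apply: (HK _ _ _ _ _ fr rep qt I); lia.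
Qed.
End Program.

(** * Writing the output *)

Definition encode_classes (cs : seq (seq nat)) : seq nat :=
  flatten [seq size c :: c | c <- cs].

Lemma decode_list_lay m a c : lay m a c -> decode_list m (size c) a = c.
Proof. by elim: c a => //= x c IH a [-> /IH ->]. Qed.

Lemma decode_classes_lay m a cs :
  lay m a (encode_classes cs) -> decode_classes m (size cs) a = cs.
Proof.
elim: cs a => //= c cs IH a [ma /lay_cat [lc lcs]].
by rewrite ma decode_list_lay // -addSn IH.
Qed.

Definition members (ord lab : nat -> nat) (i j : nat) : seq nat :=
  [seq ord k | k <- iota 0 j & lab k == i].

Lemma membersS ord lab i j :
  members ord lab i j.+1 =
  if lab j == i then rcons (members ord lab i j) (ord j) else members ord lab i j.
Proof.
by rewrite /members -(addn1 j) iotaD filter_cat map_cat /= add0n;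
  case: ifP => _ /=; rewrite ?cats1 ?cats0.
Qed.

Definition starts (lab : nat -> nat) (i : nat) : seq nat :=
  [seq k <- iota 1 i.-1 | lab k == k].

Lemma startsS lab i : 0 < i ->
  starts lab i.+1 = if lab i == i then rcons (starts lab i) i else starts lab i.
Proof.
case: i => // i _; rewrite /starts -[i.+2.-1]addn1 iotaD filter_cat /= add1n.
by case: ifP => _ /=; rewrite ?cats1 ?cats0.
Qed.

Definition parts_upto (n : nat) (ord lab : nat -> nat) (i : nat) : seq (seq nat) :=
  [seq members ord lab k n | k <- starts lab i].

Lemma encode_classes_rcons cs c :
  encode_classes (rcons cs c) = encode_classes cs ++ size c :: c.
Proof. by rewrite /encode_classes map_rcons flatten_rcons. Qed.

Section Output.

Variables (n : nat) (cl : nat -> nat -> nat) (base : nat).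
Local Notation Rep := (Rep n cl base).
Local Notation consts := (consts n base).

Lemma wp_emit Q B r m qh ord lab i o :
  consts r -> Rep m qh ord lab [::] -> i < n -> r rI = i -> r rO = o -> qh < o ->
  14 * n + 20 <= B ->
  (forall B' r' m', frame 20 r r' -> Rep m' qh ord lab [::] ->
     r' rCNT = (r rCNT).+1 -> r' rO = o.+1 + size (members ord lab i n) ->
     (forall a, a < o -> m' a = m a) ->
     lay m' o (size (members ord lab i n) :: members ord lab i n) ->
     B <= B' + 14 * n + 20 -> Q B' r' m') ->
  wp emit_code Q B r m.
Proof.
move=> cst rep lin ri ro qo hB K.
have [c1 c2 c3 c4 [c5 c6]] := cst.
rewrite /emit_code /=; apply: wp_seq; block; apply: wp_seq; rewrite addn0 addn1.
apply: (wp_while (I := fun B' r' m' => exists j,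
  [/\ [/\ frame 20 r r', Rep m' qh ord lab [::], r' rJ = j, j <= n &
         r' rO = o.+1 + size (members ord lab i j)],
      r' rH = o /\ r' rCNT = r rCNT,
      (forall a, a < o -> m' a = m a), lay m' o.+1 (members ord lab i j) &
      B <= B' + 14 * j + 6 /\ 14 * (n - j) + 10 <= B'])).
- exists 0; split=> //.
  + by split=> //; try frames; rewrite /members /= addn0; reg.
  + by lia.
- by move=> B' r' m' [j [_ _ _ _ []]]; lia.
- move=> {rep hB} B' r' m' [j [[fr rep rj _ ro'] [rh rc] low lm [b1 b2]]].
  rewrite rj (fr rN isT) c3 => jn.
  have [d1 d2 d3 d4 [d5 d6]] := consts_frame (k := 20) isT fr cst.
  have ri' : r' rI = i by rewrite fr.
  apply: wp_seq; block.
  load (rep_lab rep (ltnW jn)).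
  apply: wp_seq; eapply wp_if; [look|look|lia| |].
  + move=> ne; have ne' : (lab j == i) = false by lia.
    block; block; exists j.+1; split=> //.
    * by split=> //; [frames|reg|rewrite membersS ne'].
    * by rewrite membersS ne'.
    * by lia.
  + move=> eq0; have e : lab j == i by lia.
    block; load (rep_ord rep jn).
    block; exists j.+1; split=> //.
    * split=> //; [frames| |reg|].
        by apply: Rep_store_above rep => /=; lia.
      by rewrite membersS e size_rcons; reg.
    * by move=> a ha; rewrite updN; [exact: low|lia].
    * rewrite membersS e -cats1; apply/lay_cat; split.
        by apply: eq_lay lm => a ha; rewrite updN //; lia.
      by split=> //; rewrite updE.
    * by lia.
- move=> {rep hB} B' r' m' [j [[fr rep rj jn ro'] [rh rc] low lm [b1 b2]]].
  rewrite rj (fr rN isT) c3 => ge.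
  have ej : j = n by lia.
  rewrite {rj jn ge}ej in ro' lm b1 b2.
  have [d1 d2 d3 d4 [d5 d6]] := consts_frame (k := 20) isT fr cst.
  block; apply: K.
  + by frames.
  + by apply: Rep_store_above rep => /=; lia.
  + by reg.
  + by reg.
  + by move=> a ha; rewrite updN; [exact: low|lia].
  + split; first by rewrite updE; lia.
    by apply: eq_lay lm => a ha; rewrite updN //; lia.
  + by lia.
Qed.

Lemma wp_output Q B r m qh ord lab :
  consts r -> Rep m qh ord lab [::] -> (forall i, i <= n -> lab i <= i) ->
  0 < n -> r rQT = qh -> n * (14 * n + 40) + 10 <= B ->
  (forall B' r' m',
     decode_classes m' (m' (r' 0)) (r' 0).+1 = parts_upto n ord lab n ->
     Q B' r' m') ->
  wp output_code Q B r m.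
Proof.
move=> cst rep lle n0 rq hB K.
have [c1 c2 c3 c4 [c5 c6]] := cst.
rewrite /output_code /=; apply: wp_seq; block; apply: wp_seq; rewrite addn1.
apply: (wp_while (I := fun B' r' m' => exists i,
  [/\ [/\ frame 15 r r', Rep m' qh ord lab [::], r' rI = i, 1 <= i & i <= n],
      r' rQT = qh, r' rCNT = size (parts_upto n ord lab i),
      r' rO = qh.+1 + size (encode_classes (parts_upto n ord lab i)) /\
      lay m' qh.+1 (encode_classes (parts_upto n ord lab i)) &
      (n - i) * (14 * n + 40) + 5 <= B'])).
- exists 1; split=> //.
  + by split=> //; frames.
  + by split=> //; rewrite addn0; reg.
  + have : (n - 1) * (14 * n + 40) <= n * (14 * n + 40) by rewrite leq_mul2r leq_subr orbT.
    by lia.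
- by move=> B' r' m' [i [_ _ _ _]]; have := leq0n ((n - i) * (14 * n + 40)); lia.
- move=> {rep hB} B' r' m' [i [[fr rep ri i1 _] rq' rc [ro lm] b]].
  rewrite ri (fr rN isT) c3 => lin.
  have [d1 d2 d3 d4 [d5 d6]] := consts_frame (k := 15) isT fr cst.
  have cost : (n - i) * (14 * n + 40) = (n - i.+1) * (14 * n + 40) + 14 * n + 40.
    by rewrite -{1}(subnSK lin) mulSn; lia.
  have nn := leq0n ((n - i.+1) * (14 * n + 40)).
  apply: wp_seq; block.
  load (rep_lab rep (ltnW lin)).
  apply: wp_seq; eapply wp_if; [look|look|lia| |].
  + move=> lt; have ne' : (lab i == i) = false by lia.
    have st : parts_upto n ord lab i.+1 = parts_upto n ord lab i.
      by rewrite /parts_upto startsS ?ne'.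
    block; block; exists i.+1; rewrite st; split=> //.
    * by split=> //; [frames|reg].
    * by lia.
  + move=> ge; have e : lab i == i by rewrite eqn_leq lle ?(ltnW lin).
    have st : parts_upto n ord lab i.+1
        = rcons (parts_upto n ord lab i) (members ord lab i n).
      by rewrite /parts_upto startsS // e map_rcons.
    set r1 := (X in wp _ _ _ X _).
    have fr1 : frame 15 r r1 by frames.
    have [e1 e2 e3 e4] : [/\ r1 rI = i, r1 rO = r' rO, r1 rCNT = r' rCNT & r1 rQT = qh].
      by rewrite /r1; split; reg.
    have cst1 := consts_frame (k := 15) isT fr1 cst.
    move: (r1) fr1 e1 e2 e3 e4 cst1 => {}r1 fr1 e1 e2 e3 e4 cst1.
    apply: (wp_emit cst1 rep lin e1 e2); [by lia|by lia|].
    move=> B2 r2 m2 fr2 rep2 cn2 o2 low2 lm2 b2.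
    have g : r2 rI = i by rewrite fr2.
    have g2 : r2 rONE = 1 by rewrite fr2 // fr1.
    block; exists i.+1; rewrite st; split=> //.
    * split=> //; last by reg.
      by apply: frame_upd => // a ha; rewrite fr2 ?fr1 //; lia.
    * by etransitivity; [look|rewrite fr2].
    * by rewrite size_rcons; reg.
    * rewrite encode_classes_rcons; split.
        by rewrite size_cat /=; reg.
      apply/lay_cat; split; last by rewrite -ro.
      by apply: eq_lay lm => a ha; apply: low2; lia.
    * by lia.
- move=> {rep hB} B' r' m' [i [[fr rep ri i1 lin] rq' rc [ro lm] b]].
  rewrite ri (fr rN isT) c3 => ge.
  have ei : i = n by lia.
  rewrite {ri i1 lin ge}ei in rc ro lm b.
  have [d1 d2 d3 d4 [d5 d6]] := consts_frame (k := 15) isT fr cst.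
  block; apply: K; rewrite updE addn0 updE.
  by apply: decode_classes_lay; apply: eq_lay lm => a ha; rewrite updN //; lia.
Qed.

End Output.

(** * Reading the input *)

Definition encode_row (cs : seq (seq nat)) : seq nat := size cs :: encode_classes cs.

(** Labels descend from [size cs] to 1 because the parser writes the number of classes still to be
    read. *)
Definition class_label (cs : seq (seq nat)) (y : nat) : nat :=
  size cs - find (fun c => y \in c) cs.

Record good_row (n v : nat) (cs : seq (seq nat)) : Prop := {
  row_nonempty : all (fun c => c != [::]) cs;
  row_uniq : all uniq cs;
  row_bound : all (all (fun y => (y < n) && (y != v))) cs;
  row_count : forall y, y < n -> y != v -> count (fun c => y \in c) cs = 1 }.

Lemma size_encode_classes cs :
  size (encode_classes cs) = size cs + size (flatten cs).
Proof. by elim: cs => //= c cs IH; rewrite !size_cat IH; lia. Qed.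

Section GoodRow.

Variables (n v : nat) (cs : seq (seq nat)).
Hypothesis good : good_row n v cs.

Lemma mem_good_row y : y \in flatten cs -> (y < n) && (y != v).
Proof. by case/flattenP=> c cin; apply/allP: y; exact: (allP (row_bound good) c cin). Qed.

Lemma good_row_mem y : y < n -> y != v -> y \in flatten cs.
Proof.
move=> yn yv; have : has (fun c => y \in c) cs by rewrite has_count (row_count good).
by case/hasP=> c cin yc; apply/flattenP; exists c.
Qed.

(** The classes are duplicate-free and pairwise disjoint, so their concatenation has no
    repetition. *)
Lemma size_flatten_good_row : size (flatten cs) <= n.
Proof.
rewrite -(size_iota 0 n); apply: uniq_leq_size; last first.
  by move=> y /mem_good_row; rewrite mem_iota; lia.
apply: count_mem_uniq => y.
have -> : count_mem y (flatten cs) = count (fun c => y \in c) cs.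
  rewrite count_flatten; move: (row_uniq good); elim: (cs) => //= c l IH /andP [uc /IH ->].
  by rewrite count_uniq_mem.
have [/mem_good_row /andP [yn yv]|] := boolP (y \in flatten cs); first exact: (row_count good).
move=> ny; apply/eqP; rewrite -leqn0 leqNgt -has_count; apply: contra ny.
by case/hasP=> c cin yc; apply/flattenP; exists c.
Qed.

Lemma size_good_row : size cs <= n.
Proof.
apply: leq_trans size_flatten_good_row.
by move: (row_nonempty good); elim: (cs) => //= -[//|y c] l IH /IH; rewrite /= size_cat; lia.
Qed.

(** One cell for the number of classes, one per class size, one per vertex; this keeps the input
    below [base]. *)
Lemma size_encode_row : size (encode_row cs) <= n + n + 1.
Proof.
by rewrite /= size_encode_classes; have := size_good_row; have := size_flatten_good_row; lia.
Qed.

(** Exactly one class contains [y], so none in [ds] does and [find] stops at [c]. *)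
Lemma class_label_split ds c es y :
  cs = ds ++ c :: es -> y \in c -> class_label cs y = (size es).+1.
Proof.
move=> E yc; rewrite /class_label E find_cat.
have /mem_good_row /andP [yn yv] : y \in flatten cs.
  by apply/flattenP; exists c => //; rewrite E mem_cat mem_head orbT.
have := row_count good yn yv; rewrite E count_cat /= yc has_count.
by case: ltnP => [|_ _]; [lia|rewrite size_cat /=; lia].
Qed.

End GoodRow.

Section Parse.

Variables (n base : nat) (rows : nat -> seq (seq nat)).
Hypothesis good : forall v, v < n -> good_row n v (rows v).

Lemma wp_class Q B r m a c R k :
  lay m a c -> r rA = a -> r rEND = a + size c -> r rR = R -> r rK = k ->
  r rONE = 1 -> all (fun y => y < n) c -> a + size c <= R ->
  6 * size c + 2 <= B ->
  (forall B' r' m', frame 20 r r' -> r' rA = a + size c ->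
     (forall b, (b < R) || (R + n <= b) -> m' b = m b) ->
     (forall y, y < n -> m' (R + y) = if y \in c then k else m (R + y)) ->
     B <= B' + 6 * size c + 2 -> Q B' r' m') ->
  wp class_code Q B r m.
Proof.
move=> lm ra re rr rk r1 cn aR hB K.
apply: (wp_while (I := fun B' r' m' => exists j,
  [/\ [/\ frame 20 r r', r' rA = a + j & j <= size c],
      (forall b, (b < R) || (R + n <= b) -> m' b = m b),
      (forall y, y < n -> m' (R + y) = if y \in take j c then k else m (R + y)) &
      B <= B' + 6 * j /\ 6 * (size c - j) + 2 <= B'])).
- exists 0; split=> //; last by lia.
  + by rewrite addn0.
  + by move=> y; rewrite take0.
- by move=> B' r' m' [j [_ _ _ []]]; lia.
- move=> B' r' m' [j [[fr ra' _] low row [b1 b2]]].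
  rewrite ra' (fr rEND isT) re ltn_add2l => jc.
  have [e1 e2 e3] : [/\ r' rR = R, r' rK = k & r' rONE = 1] by rewrite !fr.
  have rd : m' (a + j) = nth 0 c j by rewrite low ?(lay_nth 0 lm) //; lia.
  have nn : nth 0 c j < n by apply: (all_nthP 0 cn).
  block; load rd.
  exists j.+1; split=> //.
  + by split=> //; [frames|reg].
  + by move=> b hb; rewrite updN ?low //; lia.
  + move=> y yn; rewrite (take_nth 0) // mem_rcons inE /upd eqn_add2l.
    by case: eqP => //= _; apply: row.
  + by lia.
- move=> B' r' m' [j [[fr ra' jc] low row [b1 b2]]].
  rewrite ra' (fr rEND isT) re leq_add2l => ge.
  have ej : j = size c by lia.
  rewrite {jc ge}ej in ra' row b1 b2.
  apply: K => //; last by lia.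
  by move=> y yn; rewrite row // take_size.
Qed.

Lemma wp_row Q B r m a v R :
  v < n -> lay m a (encode_classes (rows v)) -> r rA = a -> r rR = R ->
  r rK = size (rows v) -> r rONE = 1 -> r rZ = 0 ->
  a + size (encode_classes (rows v)) <= R -> 20 * n + 2 <= B ->
  (forall B' r' m', frame 11 r r' ->
     r' rA = a + size (encode_classes (rows v)) ->
     (forall b, (b < R) || (R + n <= b) -> m' b = m b) ->
     (forall y, y < n -> y != v -> m' (R + y) = class_label (rows v) y) ->
     B <= B' + 20 * n + 2 -> Q B' r' m') ->
  wp row_code Q B r m.
Proof.
move=> vn lm ra rr rk r1 rz aR hB K.
have gv := good vn.
apply: (wp_while (I := fun B' r' m' => exists ds es a',
  [/\ [/\ rows v = ds ++ es, frame 11 r r', r' rA = a', r' rK = size es &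
          a' + size (encode_classes es) = a + size (encode_classes (rows v))],
      lay m' a' (encode_classes es),
      (forall b, (b < R) || (R + n <= b) -> m' b = m b),
      (forall y, y < n -> y \in flatten ds -> m' (R + y) = class_label (rows v) y) &
      B <= B' + 10 * size ds + 6 * size (flatten ds) /\
      10 * size es + 6 * size (flatten es) + 2 <= B'])).
- exists [::], (rows v), a; split=> //.
  have := size_good_row gv; have := size_flatten_good_row gv; lia.
- by move=> B' r' m' [ds [es [a' [_ _ _ _ []]]]]; lia.
- move=> B' r' m' [ds [es [a' [[E fr ra' rk' sz] lm' low row [b1 b2]]]]].
  rewrite (fr rZ isT) rz rk' => es0.
  case: es E rk' sz lm' b2 es0 => // c es E rk' sz /= [mc /lay_cat [lc les]] b2 _.
  have [e1 e2 e3] : [/\ r' rR = R, r' rONE = 1 & r' rZ = 0] by rewrite !fr.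
  have szc : size (encode_classes (c :: es)) = (size c + size (encode_classes es)).+1.
    by rewrite /= size_cat.
  rewrite szc in sz; move: b2; rewrite /= size_cat => b2.
  rewrite -/(encode_classes es) in les.
  apply: wp_seq; block; load mc.
  set r2 := (X in wp _ _ _ X _).
  have fr2 : frame 11 r r2 by frames.
  have [g1 g2 g3 g4 g5] : [/\ r2 rA = a'.+1, r2 rEND = a'.+1 + size c, r2 rR = R,
      r2 rK = (size es).+1 & r2 rONE = 1].
    by rewrite /r2; split; reg.
  move: (r2) fr2 g1 g2 g3 g4 g5 => {}r2 fr2 g1 g2 g3 g4 g5.
  have cb : all (fun y => (y < n) && (y != v)) c.
    by apply: (allP (row_bound gv)); rewrite E mem_cat mem_head orbT.
  apply: wp_seq; apply: (wp_class lc g1 g2 g3 g4 g5) => //.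
  + by apply: sub_all cb => y /andP [].
  + by lia.
  + by lia.
  move=> B3 r3 m3 fr3 ra3 low3 row3 b3.
  have [k1 k2] : r3 rK = (size es).+1 /\ r3 rONE = 1 by rewrite !fr3.
  block; exists (rcons ds c), es, (a'.+1 + size c); split=> //.
  + split; [by rewrite cat_rcons| |reg|reg|lia].
    by apply: frame_upd => // b hb; rewrite fr3 ?fr2 //; lia.
  + by apply: eq_lay les => b hb; apply: low3; lia.
  + by move=> b hb; rewrite low3 // low.
  + move=> y yn; rewrite flatten_rcons mem_cat row3 //.
    case: ifP => [yc _|_]; last by rewrite orbF; apply: row.
    by rewrite (class_label_split gv E yc).
  + by rewrite size_rcons flatten_rcons size_cat; lia.
- move=> B' r' m' [ds [es [a' [[E fr ra' rk' sz] lm' low row [b1 b2]]]]].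
  rewrite (fr rZ isT) rz rk' => es0.
  have {es0} : size es = 0 by lia.
  case: es E rk' sz lm' b2 => // E _ sz _ b2 _.
  rewrite cats0 in E; rewrite -E in row b1; rewrite addn0 in sz.
  apply: K => //; first by rewrite ra'.
    by move=> y yn yv; apply: row => //; apply: (good_row_mem gv).
  have := size_good_row gv; have := size_flatten_good_row gv; lia.
Qed.

Lemma wp_parse Q B r m a :
  consts n base r -> r rR = base + n + n + n.+1 -> r rV = 0 -> r rA = a ->
  lay m a (flatten [seq encode_row (rows v) | v <- iota 0 n]) ->
  a + size (flatten [seq encode_row (rows v) | v <- iota 0 n]) <= base ->
  n * (20 * n + 20) + 5 <= B ->
  (forall B' r' m', frame 9 r r' -> r' rR = base + n + n + n.+1 + n * n ->
    (forall v, v < n -> [/\ m' (base + v) = base + n + n + n.+1 + v * n,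
        m' (base + n + v) = v & m' (base + n + n + v) = 1]) ->
    (forall v y, v < n -> y < n -> v <> y ->
       m' (base + n + n + n.+1 + v * n + y) = class_label (rows v) y) ->
    B <= B' + n * (20 * n + 20) + 5 -> Q B' r' m') ->
  wp parse_code Q B r m.
Proof.
move=> cst rr rv ra lm aB hB K.
have [c1 c2 c3 c4 [c5 c6]] := cst.
apply: (wp_while (I := fun B' r' m' => exists v a',
  let rest := flatten [seq encode_row (rows w) | w <- iota v (n - v)] in
  [/\ [/\ frame 9 r r', r' rR = base + n + n + n.+1 + v * n, r' rV = v,
          v <= n & r' rA = a'],
      lay m' a' rest /\ a' + size rest <= base,
      (forall w, w < v -> [/\ m' (base + w) = base + n + n + n.+1 + w * n,
         m' (base + n + w) = w & m' (base + n + n + w) = 1]),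
      (forall w y, w < v -> y < n -> w <> y ->
        m' (base + n + n + n.+1 + w * n + y) = class_label (rows w) y) &
      B <= B' + v * (20 * n + 20) /\ (n - v) * (20 * n + 20) + 5 <= B'])).
- exists 0, a => /=; rewrite subn0; split=> //; first by split=> //; rewrite rr; lia.
  by lia.
- move=> B' r' m' [v [a' [_ _ _ _ []]]].
  by have := leq0n ((n - v) * (20 * n + 20)); lia.
- move=> B' r' m' [v [a' /= [[fr rr' rv' _ ra'] [lm' aB'] tab lab [b1 b2]]]].
  rewrite rv' (fr rN isT) c3 => vn.
  have [d1 d2 d3 d4 [d5 d6]] := consts_frame (k := 9) isT fr cst.
  have cost : (n - v) * (20 * n + 20) = (n - v.+1) * (20 * n + 20) + 20 * n + 20.
    by rewrite -{1}(subnSK vn) mulSn; lia.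
  have nn := leq0n ((n - v.+1) * (20 * n + 20)).
  have vv := leq0n (v * n).
  move: lm' aB'; rewrite -(subnSK vn) /= size_cat => -[mk /lay_cat [lrow lrest]] aB'.
  apply: wp_seq; block; load mk.
  set r1 := (X in wp _ _ _ X _); set m1 := (X in wp _ _ _ _ X).
  have fr1 : frame 9 r r1 by frames.
  have [[g1 g2 g3 g4] g5 g6] : [/\ [/\ r1 rA = a'.+1,
      r1 rR = base + n + n + n.+1 + v * n, r1 rK = size (rows v) & r1 rONE = 1],
      r1 rZ = 0 & r1 rV = v].
    by rewrite /r1; split; [split; reg|reg|reg].
  have h1 b : m1 b = if b == base + n + n + v then 1 else
      if b == base + n + v then v else
      if b == base + v then base + n + n + n.+1 + v * n else m' b.
    by [].
  move: (r1) (m1) fr1 g1 g2 g3 g4 g5 g6 h1 => {m1}{}r1 m1 fr1 g1 g2 g3 g4 g5 g6 h1.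
  have low1 b : (b < base) || (base + n + n + n.+1 <= b) -> m1 b = m' b.
    by move=> hb; rewrite h1; do !case: eqP => ? //; lia.
  apply: wp_seq; apply: (wp_row vn _ g1 g2 g3 g4 g5).
  + by apply: eq_lay lrow => b hb; apply: low1; lia.
  + by lia.
  + by lia.
  move=> B2 r2 m2 fr2 ra2 low2 row2 b2'.
  have k0 : r2 rN = n by rewrite fr2 // fr1.
  have [k1 k2 k3] : [/\ r2 rR = base + n + n + n.+1 + v * n, r2 rV = v
     & r2 rONE = 1] by split; rewrite fr2.
  block; exists v.+1, (a'.+1 + size (encode_classes (rows v))) => /=; split.
  + split; [|reg|reg|by []|reg].
    by do !apply: frame_upd => //; move=> b hb; rewrite fr2 ?fr1 //; lia.
  + split; last by lia.
    by apply: eq_lay lrest => b hb; rewrite low2 ?low1 //; lia.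
  + move=> w wv; rewrite !low2 ?h1; try lia.
    have [->|nw] := eqVneq w v.
      by split; do !case: eqP => // ?; lia.
    have wv' : w < v by lia.
    have [t1 t2 t3] := tab w wv'.
    by rewrite t1 t2 t3; split; do !case: eqP => // ?; lia.
  + move=> w y wv yn wy; have [e|nw] := eqVneq w v.
      by rewrite e row2 //; apply/eqP => ye; apply: wy; rewrite ye.
    have wv' : w < v by lia.
    (* Row [w] of the table ends before row [v] begins, so writing row [v] spares it. *)
    have le : w * n + n <= v * n by rewrite addnC -mulSn leq_mul2r wv' orbT.
    by rewrite low2 ?low1 ?lab //; lia.
  + by rewrite mulSn; lia.
- move=> B' r' m' [v [a' /= [[fr rr' rv' vn ra'] _ tab lab [b1 b2]]]].
  rewrite rv' (fr rN isT) c3 => ge.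
  have ev : v = n by lia.
  rewrite {vn ge rv'}ev in rr' tab lab b1 b2.
  by apply: K => //; lia.
Qed.

End Parse.

(** * Correctness *)

Lemma class_label_eq n v cs y z : good_row n v cs ->
  y < n -> y != v -> z < n -> z != v ->
  (class_label cs y == class_label cs z) = has (fun c => (y \in c) && (z \in c)) cs.
Proof.
move=> good yn yv zn zv; apply/eqP/hasP => [|[c cin /andP [yc zc]]]; last first.
  case/splitPr: cin good => ds es good.
  by rewrite !(class_label_split good (erefl _)).
have hy : has (fun c => y \in c) cs by rewrite has_count (row_count good).
have hz : has (fun c => z \in c) cs by rewrite has_count (row_count good).
rewrite /class_label => e.
have ij : find (fun c => y \in c) cs = find (fun c => z \in c) cs.
  move: e (hy) (hz); rewrite !has_find.
  by move: (find _ cs) (find _ cs) (size cs) => i j k; lia.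
exists (nth [::] cs (find (fun c => y \in c) cs)); first by rewrite mem_nth -?has_find.
by rewrite (nth_find [::] hy) ij (nth_find [::] hz).
Qed.

Section Correctness.

Variables (n : nat) (H : 'I_n -> 'I_n -> 'I_n -> bool) (x : 'I_n).
Variables (cl : nat -> nat -> nat) (ord lab : nat -> nat).
Hypothesis clH : forall v y z : 'I_n, y != v -> z != v ->
  (cl v y == cl v z) = H v y z.
Hypothesis inv : Inv n x cl ord lab [::] (fun _ _ => false).

Let part (i : nat) : {set 'I_n} := [set v | val v \in members ord lab i n].

Lemma mem_members i v :
  reflect (exists k, [/\ k < n, lab k = i & ord k = v]) (v \in members ord lab i n).
Proof.
apply: (iffP mapP) => [[k]|[k [kn lk ok]]].
  by rewrite mem_filter mem_iota => /andP [/eqP lk /andP [_ kn]] ->; exists k.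
by exists k => //; rewrite mem_filter mem_iota lk eqxx.
Qed.

Lemma mem_starts i : (i \in starts lab n) = [&& 0 < i, i < n & lab i == i].
Proof. by rewrite mem_filter mem_iota; case: (lab i == i); lia. Qed.

(** An injection of [[0, n)] into itself is onto, by counting. *)
Lemma position (v : 'I_n) : exists2 k, k < n & ord k = v.
Proof.
have un : uniq (map ord (iota 0 n)).
  rewrite map_inj_in_uniq ?iota_uniq // => a b.
  by rewrite !mem_iota !add0n => /andP [_ an] /andP [_ bn]; apply: (ord_injective inv).
have sub : {subset map ord (iota 0 n) <= iota 0 n}.
  move=> a /mapP [k]; rewrite !mem_iota !add0n => /andP [_ kn] ->.
  by rewrite (ord_lt inv).
have [|_ eqm] := uniq_min_size un sub; first by rewrite size_map.
have : val v \in map ord (iota 0 n) by rewrite eqm mem_iota add0n ltn_ord.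
by case/mapP=> k; rewrite mem_iota => /andP [_ kn] ->; exists k.
Qed.

Lemma position_lt k (kn : k < n) : exists v : 'I_n, val v = ord k.
Proof. by exists (Ordinal (ord_lt inv kn)). Qed.

Lemma part_homogeneous i : i \in starts lab n ->
  homogeneous_set H (part i) && (x \notin part i).
Proof.
rewrite mem_starts => /and3P [i0 lin /eqP li].
rewrite /homogeneous_set -andbA; apply/and3P; split.
- have [v vi] := position_lt lin; apply/set0Pn; exists v; rewrite inE.
  by apply/mem_members; exists i.
- apply/forall_inP => s; rewrite !inE => si.
  apply/existsP => -[y /andP [yi /existsP [z /andP [zi]]]].
  move: yi zi; rewrite !inE => yi zi /negP; apply.
  rewrite -clH; try by apply: contraNneq si => <-.
  have [u un uo] := position s; have [a [an la ao]] := mem_members _ _ yi.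
  have [b [bn lb bo]] := mem_members _ _ zi.
  rewrite -uo -ao -bo; apply/eqP; apply: (settled inv) => //; first by rewrite la lb.
  by rewrite la => lu; move/negP: si; apply; apply/mem_members; exists u.
- rewrite inE; apply/mem_members => -[k [kn lk ok]].
  have n0 : 0 < n by lia.
  have k0 : k = 0 by apply: (ord_injective inv) => //; rewrite (ord_first inv).
  by have := lab_le inv (leq0n n); rewrite -k0 lk; lia.
Qed.

Lemma homogeneous_sub_part M : homogeneous_set H M -> x \notin M ->
  exists2 i, i \in starts lab n & M \subset part i.
Proof.
case/andP=> /set0Pn [y yM] /forall_inP hom xM.
(* [M] carried over to [nat], where [closed_lab] applies. *)
pose S k := [exists v : 'I_n, (v \in M) && (val v == k)].
have SE (v : 'I_n) : S v = (v \in M).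
  apply/existsP/idP => [[w /andP [wM /eqP /val_inj <-]] //|vM].
  by exists v; rewrite vM eqxx.
have cS : undistinguished n cl S.
  move=> s a b sn an bn; rewrite -[s]/(val (Ordinal sn)) -[a]/(val (Ordinal an)).
  rewrite -[b]/(val (Ordinal bn)) !SE => sM aM bM.
  apply/eqP; rewrite clH; try by apply: contraNneq sM => <-.
  have := hom (Ordinal sn); rewrite inE sM => /(_ isT) /existsP nd.
  apply/negPn/negP => nh; apply: nd; exists (Ordinal an); rewrite aM /=.
  by apply/existsP; exists (Ordinal bn); rewrite bM.
have [k kn ok] := position y.
have lk := lab_le inv (ltnW kn).
exists (lab k).
  rewrite mem_starts (lab_id inv (ltnW kn)) eqxx (leq_ltn_trans lk kn) !andbT.
  have k0 : 0 < k.
    rewrite lt0n; apply: contraNneq xM => k0.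
    by rewrite (_ : x = y) //; apply: val_inj; rewrite /= -ok k0 (ord_first inv).
  by have := lab_mono inv k0 (ltnW kn); rewrite (lab1 inv).
apply/subsetP => z zM; rewrite inE; apply/mem_members.
have [j jn oj] := position z; exists j; split=> //.
by apply: (closed_lab inv cS) => //; rewrite ?oj ?ok SE.
Qed.

Lemma part_subset i j : i \in starts lab n -> part i \subset part j -> i = j.
Proof.
rewrite mem_starts => /and3P [_ lin /eqP li] /subsetP sub.
have [v vi] := position_lt lin.
have /sub : v \in part i by rewrite inE; apply/mem_members; exists i.
rewrite inE => /mem_members [k [kn lk]]; rewrite vi => /(ord_injective inv kn lin) e.
by rewrite -lk e li.
Qed.

(** Parts are homogeneous, absorb every homogeneous set avoiding [x], and are pairwise
    incomparable. *)
Lemma MHS_part M : (M \in MHS H x) = has (fun i => M == part i) (starts lab n).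
Proof.
rewrite inE; apply/maxsetP/hasP => [[/andP [hM xM] maxM]|[i iS /eqP ->]].
  have [i iS sub] := homogeneous_sub_part hM xM; exists i => //.
  by rewrite (maxM (part i)) // part_homogeneous.
split; first exact: part_homogeneous.
move=> N /andP [hN xN] sub; have [j jS sub'] := homogeneous_sub_part hN xN.
apply/eqP; rewrite eqEsubset sub andbT.
by rewrite (part_subset iS (subset_trans sub sub')).
Qed.

Lemma parts_MHS : represents_MHS H x (parts_upto n ord lab n).
Proof.
split.
- apply/allP => c /mapP [i _ ->]; apply/andP; split.
    rewrite map_inj_in_uniq ?filter_uniq ?iota_uniq // => a b.
    rewrite !mem_filter !mem_iota !add0n => /and3P [_ _ an] /and3P [_ _ bn].
    exact: (ord_injective inv).
  by apply/allP => v /mem_members [k [kn _ <-]]; apply: (ord_lt inv).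
(* Distinct starts give distinct parts, so the length of the list is a cardinality. *)
- have un : uniq (map part (starts lab n)).
    rewrite map_inj_in_uniq ?filter_uniq ?iota_uniq // => i j iS _ e.
    by apply: part_subset => //; rewrite e.
  rewrite size_map -(size_map part) -(card_uniqP un); apply: eq_card => M.
  rewrite MHS_part; apply/mapP/hasP => [[i iS ->]|[i iS /eqP ->]]; exists i => //.
- move=> M; rewrite MHS_part /parts_upto has_map.
  by apply: eq_has.
Qed.

End Correctness.

(** * Initial configuration and the complete run *)

Definition initial_ord (x i : nat) : nat := if i == x then 0 else if i == 0 then x else i.

Definition initial_lab (n i : nat) : nat := if i == 0 then 0 else if i == n then n else 1.

(** Positions with different labels lie on the two sides of [(0, 1, n)], so nothing is due to be
    settled; a set avoiding [x] misses position 0, and all others share label 1. *)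
Lemma Inv_initial n x cl : 1 < n -> x < n ->
  Inv n x cl (initial_ord x) (initial_lab n) [:: (0, 1, n)] (fun _ _ => false).
Proof.
move=> n1 xn; rewrite /initial_ord /initial_lab; split.
- by move=> i; do !case: eqP => //; lia.
- by move=> i j; do !case: eqP => //; lia.
- by case: eqP.
- by rewrite /=; case: eqP => // <-.
- by case: eqP => // _; rewrite eqxx.
- by move=> i; do !case: eqP => //; lia.
- by move=> i _; do !case: eqP => //; lia.
- by move=> i j; do !case: eqP => //; lia.
- have first : (if 0 == x then 0 else x) = x by case: eqP.
  move=> S i j _ /negP Sx inn jn; case: (i =P 0) => [->|i0]; first by rewrite first => /Sx.
  by case: (j =P 0) => [->|j0]; [rewrite first => _ /Sx|do !case: eqP => //; lia].
- move=> u i j un inn jn lij lui; rewrite /pending /= orbF => np _.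
  by move: lij lui np; do !case: eqP => //; lia.
- by rewrite /= n1 leqnn eqxx; do !case: eqP => //; lia.
Qed.

Lemma potential_initial n : 0 < n ->
  potential n (initial_lab n) [:: (0, 1, n)] <= 300 * n * n + 200 * n.
Proof.
move=> n0; rewrite /potential -lock /work /=.
have : same_part_pairs n (initial_lab n) <= n * n.
  rewrite /same_part_pairs -[X in _ <= X * _]subn0 -sum_nat_const_nat.
  by rewrite big_nat [X in _ <= X]big_nat; apply: leq_sum => i; lia.
lia.
Qed.

Section Whole.

Variables (n x : nat) (rows : nat -> seq (seq nat)).
Hypotheses (n1 : 1 < n) (xn : x < n).
Hypothesis good : forall v, v < n -> good_row n v (rows v).

Let base := 2 + n * (n + n + n).
Let cl v y := class_label (rows v) y.

Lemma wp_base Q B r m :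
  (forall a, r a = 0) -> m 0 = n -> m 1 = x -> 6 * n + 11 <= B ->
  (forall B' r', consts n base r' -> r' rX = x ->
     r' rR = base + n + n + n.+1 -> r' rV = 0 -> r' rA = 2 ->
     B <= B' + 6 * n + 11 -> Q B' r' m) ->
  wp base_code Q B r m.
Proof.
move=> r0 m0 m1 hB K.
have [z1 z2 z3] : [/\ r rZ = 0, r rI = 0 & r rV = 0] by rewrite !r0.
rewrite /base_code /=; apply: wp_seq; block.
load m0; load m1.
apply: wp_seq.
apply: (wp_while (I := fun B' r' m' => exists i,
  [/\ [/\ r' rZ = 0, r' rONE = 1, r' rN = n & r' rX = x], r' rV = 0,
      r' rI = i /\ i <= n, r' rROW = 2 + i * (n + n + n) /\ m' = m &
      B <= B' + 4 + 6 * i /\ 6 * (n - i) + 7 <= B'])).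
- by exists 0; split=> //; lia.
- by move=> B' r' m' [i [_ _ _ _ []]]; lia.
- move=> B' r' m' [i [[d1 d2 d3 d4] d5 [ri _] [rr ->] [b1 b2]]].
  rewrite ri d3 => lin; block; exists i.+1; split=> //.
  + by split=> //; reg.
  + by split=> //; etransitivity; [look|rewrite mulSn; lia].
  + by lia.
- move=> B' r' m' [i [[d1 d2 d3 d4] d5 [ri lin] [rr ->] [b1 b2]]].
  rewrite ri d3 => ge.
  have ei : i = n by lia.
  rewrite {ri lin ge}ei -/base in rr b1 b2.
  block; apply: K; [by split; [| | | |split]; reg|reg|reg|reg|reg|by lia].
Qed.

Lemma wp_start Q B r m :
  consts n base r -> r rX = x -> r rR = base + n + n + n.+1 + n * n ->
  (forall v, v < n -> [/\ m (base + v) = base + n + n + n.+1 + v * n,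
     m (base + n + v) = v & m (base + n + n + v) = 1]) ->
  (forall v y, v < n -> y < n -> v <> y ->
     m (base + n + n + n.+1 + v * n + y) = cl v y) ->
  14 <= B ->
  (forall B' r' m', consts n base r' -> B <= B' + 14 ->
     Rep n cl base m' (r' rQH) (initial_ord x) (initial_lab n) [:: (0, 1, n)] ->
     r' rQT = r' rQH + 3 -> Q B' r' m') ->
  wp start_code Q B r m.
Proof.
move=> cst rx rr tab lab hB K.
have [c1 c2 c3 c4 [c5 c6]] := cst.
have nn := leq0n (n * n).
block; rewrite !addn0.
set q := base + n + n + n.+1 + n * n in rr *; apply: K.
- by split; [| | | |split]; reg.
- by lia.
- set qh := (X in Rep _ _ _ _ X _ _ _); have -> : qh = q by rewrite /qh; look.
  (* The present memory contents serve as [ord] and [lab], so that the stores become updates of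
     them. *)
  have rep : Rep n cl base m q (fun i => m (base + n + i))
      (fun i => m (base + n + n + i)) [::].
    by split=> // v vn; have [] := tab v vn.
  have rep1 := Rep_store_lab 0 (esym (addn0 _)) (leq0n n) rep.
  have rep2 := Rep_store_lab n (erefl _) (leqnn n) rep1.
  have rep3 := Rep_store_ord x (esym (addn0 _)) (ltnW n1) rep2.
  have rep4 := Rep_store_ord 0 (erefl _) xn rep3.
  have q0 : q = q + 3 * @size item [::] by rewrite muln0 addn0.
  have := Rep_push 0 1 n q0 rep4; rewrite !addn1.
  apply: Rep_eq => i inn.
    rewrite /upd /initial_ord; do 2 (case: eqP => // _).
    by have [] := tab i inn.
  rewrite /upd /initial_lab; case: (i =P n) => [->|ne].
    by rewrite ifF //; apply/eqP; lia.
  by case: eqP => // _; have [|_ _ ->] := tab i; lia.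
- by rewrite /upd /=; lia.
Qed.

Lemma wp_mhs Q B r m :
  (forall a, r a = 0) -> lay m 0 [:: n, x & flatten [seq encode_row (rows v) | v <- iota 0 n]] ->
  1000 * n ^ 2 <= B ->
  (forall B' r' m' ord lab, Inv n x cl ord lab [::] (fun _ _ => false) ->
     decode_classes m' (m' (r' 0)) (r' 0).+1 = parts_upto n ord lab n ->
     Q B' r' m') ->
  wp mhs_code Q B r m.
Proof.
move=> r0 [m0 [m1 lm]] hB K.
have sq : n <= n * n by rewrite leq_pmull // ltnW.
have size_input : 2 + size (flatten [seq encode_row (rows v) | v <- iota 0 n]) <= base.
  rewrite /base leq_add2l.
  have : forall l, {subset l <= iota 0 n} ->
      size (flatten [seq encode_row (rows v) | v <- l]) <= size l * (n + n + n).
    elim=> // v l IH sub; rewrite map_cons.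
    rewrite -[flatten _]/(encode_row (rows v) ++ flatten [seq encode_row (rows w) | w <- l]).
    rewrite size_cat [size (v :: l)]/= mulSn.
    have vn : v < n by have := sub v (mem_head v l); rewrite mem_iota; lia.
    apply: leq_add; first by apply: leq_trans (size_encode_row (good vn)) _; lia.
    by apply: IH => w wl; apply: sub; rewrite inE wl orbT.
  by move=> /(_ (iota 0 n)); rewrite size_iota; apply.
(* The stages together need at most 334n^2 + 266n + 42 steps; 1000n^2 leaves ample room. *)
rewrite /mhs_code; apply: wp_seq; apply: (wp_base r0 m0 m1); first by lia.
move=> B1 r1 cst1 x1 R1 V1 A1 b1.
apply: wp_seq; apply: (wp_parse good cst1 R1 V1 A1 lm size_input); first by lia.
move=> B2 r2 m2 fr2 R2 tab2 lab2 b2.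
apply: wp_seq; apply: (wp_start (consts_frame (k := 9) isT fr2 cst1) _ R2 tab2 lab2).
- by rewrite fr2.
- by lia.
move=> B3 r3 m3 cst3 b3 rep3 qt3.
have pot := potential_initial (ltnW n1).
apply: wp_seq; apply: (wp_main (K := n * (14 * n + 40) + 10) cst3 rep3 qt3).
- exact: Inv_initial.
- by lia.
move=> B4 r4 m4 ord lab fr4 rep4 qt4 I4 b4.
apply: (wp_output (consts_frame (k := 8) isT fr4 cst3) rep4 (lab_le I4)) => //.
  by rewrite ltnW.
by move=> B5 r5 m5; apply: K I4.
Qed.

End Whole.

Definition input_rows n (P : 'I_n -> seq (seq 'I_n)) (v : nat) : seq (seq nat) :=
  if insub v is Some o then [seq map val c | c <- P o] else [::].

Lemma input_rowsE n (P : 'I_n -> seq (seq 'I_n)) (v : 'I_n) :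
  input_rows P v = [seq map val c | c <- P v].
Proof. by rewrite /input_rows valK. Qed.

Section Input.

Variables (n : nat) (H : 'I_n -> 'I_n -> 'I_n -> bool) (P : 'I_n -> seq (seq 'I_n)).
Hypothesis valid : valid_input H P.

Lemma good_input_rows v : v < n -> good_row n v (input_rows P v).
Proof.
move=> vn; rewrite -[v]/(val (Ordinal vn)); set o := Ordinal vn.
have [wf cnt _] := valid o; rewrite input_rowsE; split.
- by rewrite all_map; apply: sub_all wf => -[|y c].
- rewrite all_map; apply: sub_all wf => c /andP [/andP [_ uc] _].
  by rewrite /= (map_inj_uniq val_inj).
- rewrite all_map; apply: sub_all wf => c /andP [_ oc]; rewrite /= all_map.
  apply/allP => y yc /=; rewrite ltn_ord /=; apply: contraNneq oc => e.
  by have <- : y = o by exact: val_inj.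
- move=> y yn yo; rewrite count_map -(cnt (Ordinal yn)); last by [].
  by apply: eq_count => c; rewrite /= -[y]/(val (Ordinal yn)) (mem_map val_inj).
Qed.

Lemma class_label_input (v y z : 'I_n) : y != v -> z != v ->
  (class_label (input_rows P v) y == class_label (input_rows P v) z) = H v y z.
Proof.
move=> yv zv; have [_ _ ->] := valid v => //.
rewrite (class_label_eq (good_input_rows (ltn_ord v))) // input_rowsE has_map.
by apply: eq_has => c; rewrite /= !(mem_map val_inj).
Qed.

Lemma encode_inputE (x : 'I_n) : encode_input x P =
  [:: n, val x & flatten [seq encode_row (input_rows P v) | v <- iota 0 n]].
Proof.
rewrite /encode_input -val_enum_ord -map_comp /=; do 3 f_equal.
apply: eq_map => v; rewrite /encode_row /encode_classes /= input_rowsE size_map.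
rewrite -map_comp; do 2 f_equal.
by apply: eq_map => c /=; rewrite size_map.
Qed.

End Input.

(* There is a single RAM program and a constant c such that, for every
   V = 'I_n with n >= 2, every homogeneous relation H on V, every x, and
   every input listing of the partitions of V \ {v} into H_v-classes,
   the program halts within c * n^2 steps with MHS(x) as output. *)
Theorem mainTheorem12 :
  exists (prog : seq instr) (c : nat),
  forall (n : nat), 2 <= n ->
  forall (H : 'I_n -> 'I_n -> 'I_n -> bool), homogeneous_relation H ->
  forall (x : 'I_n) (P : 'I_n -> seq (seq 'I_n)), valid_input H P ->
  exists (t : nat) (s : rstate),
    [/\ t <= c * n ^ 2,
        exec prog t (init_state (encode_input x P)) = Some s,
        halted prog s &
        represents_MHS H x (output s)].
Proof.
exists (code 0 mhs_code), 1000 => n n2 H _ x P valid.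
have prog : lay (nth IHalt (code 0 mhs_code)) 0 (code 0 mhs_code).
  exact: nth_lay.
pose Q (_ : nat) r m := represents_MHS H x (output (RState 0 r m)).
have spec : wp mhs_code Q (1000 * n ^ 2) (fun _ => 0)
    (fun a => nth 0 (encode_input x P) a).
  apply: (wp_mhs n2 (ltn_ord x) (good_input_rows valid)) => //.
    by rewrite -encode_inputE; apply: nth_lay.
  move=> B' r' m' ord lab I out; rewrite /Q /output /= out.
  apply: (parts_MHS _ I) => v y z; exact: class_label_input.
have [t [r [m [B' [tB ex out]]]]] := wp_sound prog spec.
exists t, (RState (0 + len mhs_code) r m); split; [lia|exact: ex| |exact: out].
(* The run ends just past the last instruction, where [nth] returns its default [IHalt]. *)
by rewrite /halted /step nth_default ?size_code.
Qed.
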